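(* Let $P$ be a partial lattice, let $S$ be a conditionally co-Brouwerian lattice, and let $\varphi\colon\mathrm{Con}_{\mathrm c}\,P\to S$ be a $\langle\vee,0\rangle$-homomorphism. Then $\varphi$ has a good lift, in both the ideal and the filter version. Explicitly, there exist a relatively complemented lattice $L$, a homomorphism $f\colon P\to L$ of partial lattices, and an isomorphism $\psi\colon\mathrm{Con}_{\mathrm c}\,L\to S$ such that $\varphi=\psi\circ\mathrm{Con}_{\mathrm c}\,f$, the range of $f$ generates $L$ as an ideal, and, if the range of $\varphi$ is cofinal in $S$, then the range of $f$ generates $L$ as a convex sublattice. Likewise, there exist such $L$, $f$, $\psi$ with the same properties except that ''the range of $f$ generates $L$ as an ideal'' is replaced by ''the range of $f$ generates $L$ as a filter''.
   Context: A $\langle\vee,0\rangle$-semilattice is a join-semilattice with least element $0$; a $\langle\vee,0\rangle$-homomorphism is a map preserving $\vee$ and $0$. A $\langle\vee,0\rangle$-semilattice is co-Brouwerian if it is a complete lattice satisfying $a\vee\bigwedge_{i\in I}x_i=\bigwedge_{i\in I}(a\vee x_i)$ for all elements $a$ and families $(x_i)_{i\in I}$; it is conditionally co-Brouwerian if each of its principal ideals is co-Brouwerian. For a quasi-ordered set $P$, $X\subseteq P$ and $a\in P$, ''$a=\sup X$'' means that $a$ is an upper bound of $X$ and $a\le x$ for every upper bound $x$ of $X$; ''$a=\inf X$'' is defined dually. A partial prelattice is a structure $\langle P,\le,\bigvee,\bigwedge\rangle$ where $P$ is a nonempty set, $\le$ is a quasi-ordering on $P$, and $\bigvee,\bigwedge$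 are partial functions from the set of nonempty finite subsets of $P$ to $P$ such that $a=\bigvee X$ implies $a=\sup X$ and $a=\bigwedge X$ implies $a=\inf X$. It is a partial lattice if $\le$ is antisymmetric. Lattices are identified with the partial lattices in which $\bigvee,\bigwedge$ are defined on all nonempty finite subsets. A congruence of $P$ is a quasi-ordering $\preceq$ of $P$ containing $\le$ such that $\langle P,\preceq,\bigvee,\bigwedge\rangle$ is a partial prelattice. The set $\mathrm{Con}\,P$ of all congruences of $P$, ordered by inclusion, is an algebraic lattice, and $\mathrm{Con}_{\mathrm c}\,P$ denotes the $\langle\vee,0\rangle$-semilattice of its compact elements. A homomorphism $f\colon P\to Q$ of partial lattices is an order-preserving map such that $a=\bigvee X$ implies $f(a)=\bigvee f[X]$ and $a=\bigwedge X$ implies $f(a)=\bigwedge f[X]$. The map $\mathrm{Con}_{\mathrm c}\,f\colon\mathrm{Con}_{\mathrm c}\,P\to\mathrm{Con}_{\mathrm c}\,Q$ sends $\boldsymbol a$ to the least congruence of $Q$ containing all pairs $\langle f(x),f(y)\rangle$ with $\langle x,y\rangle\in\boldsymbol a$. *)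

(* Defs.v *)
From HB Require Import structures.
From Stdlib Require Import RelationClasses.
From mathcomp Require Import all_boot all_order.
From mathcomp Require Import boolp classical_sets functions cardinality.

Set Implicit Arguments.
Unset Strict Implicit.
Unset Printing Implicit Defensive.

Import Order.Theory.
Local Open Scope classical_set_scope.
Local Open Scope order_scope.

Definition join0_morphism d (A : bJoinSemilatticeType d)
    d' (B : bJoinSemilatticeType d') (f : A -> B) : Prop :=
  f \bot = \bot /\ {morph f : x y / x `|` y}.

Definition join0_isomorphism d (A : bJoinSemilatticeType d)
    d' (B : bJoinSemilatticeType d') (f : A -> B) : Prop :=
  join0_morphism f /\ bijective f.

Definition complete_lattice d (T : porderType d) : Prop :=
  forall A : set T, supremums A !=set0 /\ infimums A !=set0.

(* A family (x_i) enters the infinite distributive law only through its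
   range A. *)
Definition co_brouwerian d (T : bJoinSemilatticeType d) : Prop :=
  complete_lattice T /\
  forall (a : T) (A : set T) (m : T),
    infimums A m -> infimums [set a `|` x | x in A] (a `|` m).

Record principal_ideal d (T : porderType d) (s : T) : Type :=
  PrincipalIdeal { ideal_val : T; ideal_valP : ideal_val <= s }.

HB.instance Definition _ d (T : porderType d) (s : T) :=
  [isSub for @ideal_val d T s].
HB.instance Definition _ d (T : porderType d) (s : T) :=
  [Choice of principal_ideal s by <:].
HB.instance Definition _ d (T : porderType d) (s : T) :=
  [SubChoice_isSubPOrder of principal_ideal s by <: with d].

Section PrincipalIdeal.
Context d (T : bJoinSemilatticeType d) (s : T).
Implicit Types x y z : principal_ideal s.

Lemma leE_ideal x y : (x <= y) = (ideal_val x <= ideal_val y).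
Proof. by []. Qed.

Fact ideal_join_subproof x y : ideal_val x `|` ideal_val y <= s.
Proof. by rewrite leUx !ideal_valP. Qed.

Definition ideal_join x y := PrincipalIdeal (ideal_join_subproof x y).

Fact ideal_leUx x y z : (ideal_join x y <= z) = (x <= z) && (y <= z).
Proof. by rewrite !leE_ideal leUx. Qed.

HB.instance Definition _ :=
  @Order.POrder_isJoinSemilattice.Build d (principal_ideal s)
    ideal_join ideal_leUx.

Definition ideal_bot : principal_ideal s := PrincipalIdeal (le0x s).

Fact ideal_le0x x : ideal_bot <= x.
Proof. by rewrite leE_ideal le0x. Qed.

HB.instance Definition _ :=
  @Order.hasBottom.Build d (principal_ideal s) ideal_bot ideal_le0x.
End PrincipalIdeal.

Definition conditionally_co_brouwerian d (T : bJoinSemilatticeType d) : Prop :=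
  forall s : T, co_brouwerian (principal_ideal s).

Definition compact_elt d (T : porderType d) (c : T) : Prop :=
  forall (A : set T) (s : T), supremums A s -> c <= s ->
  exists F : set T, [/\ F `<=` A, finite_set F &
    exists2 t, supremums F t & c <= t].

Definition rel_sup (T : Type) (le : T -> T -> Prop) (X : set T) (a : T) : Prop :=
  (forall x, X x -> le x a) /\
  (forall b, (forall x, X x -> le x b) -> le a b).

Definition rel_inf (T : Type) (le : T -> T -> Prop) (X : set T) (a : T) : Prop :=
  rel_sup (fun x y => le y x) X a.

(* Partial functions from the nonempty finite subsets of T to T, given by
   their graphs: [o X a] means that [o] is defined at [X] with value [a]. *)
Record partial_op (T : Type) : Type := PartialOp {
  op_graph :> set T -> T -> Prop;
  op_functional : forall X a b, op_graph X a -> op_graph X b -> a = b;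
  op_domain : forall X a, op_graph X a -> finite_set X /\ X !=set0 }.

Record is_partial_prelattice (T : Type) (le : T -> T -> Prop)
    (J M : partial_op T) : Prop := IsPartialPrelattice {
  pre_inhabited : inhabited T;
  pre_preorder : PreOrder le;
  pre_join_sup : forall X a, J X a -> rel_sup le X a;
  pre_meet_inf : forall X a, M X a -> rel_inf le X a }.

Record partialLattice : Type := PartialLattice {
  pl_sort :> Type;
  ple : pl_sort -> pl_sort -> Prop;
  pjoin : partial_op pl_sort;
  pmeet : partial_op pl_sort;
  pl_prelattice : is_partial_prelattice ple pjoin pmeet;
  pl_anti : forall x y, ple x y -> ple y x -> x = y }.

Arguments ple {p}.
Arguments pjoin {p}.
Arguments pmeet {p}.

Record plHom (P Q : partialLattice) : Type := PLHom {
  plhom_fun :> P -> Q;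
  plhom_mono : forall x y, ple x y -> ple (plhom_fun x) (plhom_fun y);
  plhom_join : forall X a, pjoin X a -> pjoin (plhom_fun @` X) (plhom_fun a);
  plhom_meet : forall X a, pmeet X a -> pmeet (plhom_fun @` X) (plhom_fun a) }.

Section LatticeAsPartialLattice.
Context d (L : latticeType d) (L0 : inhabited L).

Definition lattice_le (x y : L) : Prop := x <= y.

Definition lattice_join_graph (X : set L) (a : L) : Prop :=
  [/\ finite_set X, X !=set0 & supremums X a].

Definition lattice_meet_graph (X : set L) (a : L) : Prop :=
  [/\ finite_set X, X !=set0 & infimums X a].

Fact lattice_join_functional X a b :
  lattice_join_graph X a -> lattice_join_graph X b -> a = b.
Proof.
move=> [_ _ [ua la]] [_ _ [ub lb]]; apply/le_anti/andP.
by split; [apply: la|apply: lb].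
Qed.

Fact lattice_meet_functional X a b :
  lattice_meet_graph X a -> lattice_meet_graph X b -> a = b.
Proof.
move=> [_ _ [ua la]] [_ _ [ub lb]]; apply/le_anti/andP.
by split; [apply: lb|apply: la].
Qed.

Fact lattice_join_domain X a :
  lattice_join_graph X a -> finite_set X /\ X !=set0.
Proof. by case. Qed.

Fact lattice_meet_domain X a :
  lattice_meet_graph X a -> finite_set X /\ X !=set0.
Proof. by case. Qed.

Definition lattice_pjoin := PartialOp lattice_join_functional lattice_join_domain.
Definition lattice_pmeet := PartialOp lattice_meet_functional lattice_meet_domain.

Fact lattice_is_prelattice :
  is_partial_prelattice lattice_le lattice_pjoin lattice_pmeet.
Proof.
split=> //.
- by split=> [x|x y z]; [exact: lexx|exact: le_trans].
- by move=> X a [].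
- by move=> X a [].
Qed.

Fact lattice_anti x y : lattice_le x y -> lattice_le y x -> x = y.
Proof. by move=> xy yx; apply/le_anti/andP. Qed.

Definition partial_of_lattice : partialLattice :=
  PartialLattice lattice_is_prelattice lattice_anti.

Fact lattice_pjoinE (X : set L) :
  finite_set X -> X !=set0 -> exists a, lattice_pjoin X a.
Proof.
move=> finX X0; suff [a Xa] : supremums X !=set0 by exists a; split.
case/(finite_seqP X): finX X0 => s ->; elim: s => [|x s IHs] [y /= ys] //.
have [->|s0] := eqVneq s [::].
  by exists x; split=> [z|z zub] /=; rewrite ?inE; [move/eqP->|apply: zub; rewrite /= inE].
have [a [ua la]] : supremums [set` s] !=set0.
  by apply: IHs; case: (s) s0 => // u t _; exists u; rewrite /= mem_head.
exists (x `|` a); split=> [z|z zub] /=.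
  rewrite inE => /orP[/eqP->|zs]; first exact: leUl.
  by apply: le_trans (leUr _ _); apply: ua.
rewrite leUx zub /= ?mem_head //=; apply: la => t ts.
by apply: zub; rewrite /= inE ts orbT.
Qed.

Fact lattice_pmeetE (X : set L) :
  finite_set X -> X !=set0 -> exists a, lattice_pmeet X a.
Proof.
move=> finX X0; suff [a Xa] : infimums X !=set0 by exists a; split.
case/(finite_seqP X): finX X0 => s ->; elim: s => [|x s IHs] [y /= ys] //.
have [->|s0] := eqVneq s [::].
  by exists x; split=> [z|z zlb] /=; rewrite ?inE; [move/eqP->|apply: zlb; rewrite /= inE].
have [a [ua la]] : infimums [set` s] !=set0.
  by apply: IHs; case: (s) s0 => // u t _; exists u; rewrite /= mem_head.
exists (x `&` a); split=> [z|z zlb] /=.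
  rewrite inE => /orP[/eqP->|zs]; first exact: leIl.
  by apply: le_trans (leIr _ _) _; apply: ua.
rewrite lexI zlb /= ?mem_head //=; apply: la => t ts.
by apply: zlb; rewrite /= inE ts orbT.
Qed.

End LatticeAsPartialLattice.

Record is_congruence (P : partialLattice) (r : P -> P -> Prop) : Prop :=
  IsCongruence {
    congr_ple : forall x y, ple x y -> r x y;
    congr_prelattice : is_partial_prelattice r pjoin pmeet }.

Record con (P : partialLattice) : Type := Con {
  con_rel :> P -> P -> Prop;
  con_congr : is_congruence con_rel }.

Fact con_display : Order.disp_t. Proof. exact: (Order.Disp tt tt). Qed.

Section ConOrder.
Context (P : partialLattice).

Lemma con_eq (a b : con P) : (forall x y, a x y <-> b x y) -> a = b.
Proof.
case: a b => [r cr] [r' cr'] /= rr'.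
have {rr'} rr' : r = r' by apply/funext=> x; apply/funext=> y; apply/propext.
by case: _ / rr' in cr' *; congr Con; exact: Prop_irrelevance.
Qed.

Definition con_le (a b : con P) : bool := `[< forall x y, a x y -> b x y >].

Fact con_le_refl : reflexive con_le. Proof. by move=> a; apply/asboolP. Qed.

Fact con_le_anti : antisymmetric con_le.
Proof.
by move=> a b /andP[/asboolP ab /asboolP ba]; apply: con_eq => x y; split; auto.
Qed.

Fact con_le_trans : transitive con_le.
Proof.
by move=> b a c /asboolP ab /asboolP bc; apply/asboolP=> x y /ab; exact: bc.
Qed.

HB.instance Definition _ := gen_eqMixin (con P).
HB.instance Definition _ := gen_choiceMixin (con P).
HB.instance Definition _ := @Order.Le_isPOrder.Build con_display (con P)
  con_le con_le_refl con_le_anti con_le_trans.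

Lemma con_leP (a b : con P) : reflect (forall x y, a x y -> b x y) (a <= b).
Proof. exact: asboolP. Qed.

Definition con_graph (a : con P) : set (P * P) := [set p | a p.1 p.2].

Lemma con_refl (a : con P) x : a x x.
Proof. by case: (pre_preorder (congr_prelattice (con_congr a))) => + _; apply. Qed.

Lemma con_trans (a : con P) x y z : a x y -> a y z -> a x z.
Proof.
by case: (pre_preorder (congr_prelattice (con_congr a))) => _; apply.
Qed.

Lemma con_join (a : con P) X u : pjoin X u ->
  (forall x, X x -> a x u) /\ (forall b, (forall x, X x -> a x b) -> a u b).
Proof. exact: (pre_join_sup (congr_prelattice (con_congr a))). Qed.

Lemma con_meet (a : con P) X u : pmeet X u ->
  (forall x, X x -> a u x) /\ (forall b, (forall x, X x -> a b x) -> a b u).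
Proof. exact: (pre_meet_inf (congr_prelattice (con_congr a))). Qed.

Definition con_gen_rel (G : set (P * P)) (x y : P) : Prop :=
  forall c : con P, G `<=` con_graph c -> c x y.

Fact con_gen_congr G : is_congruence (con_gen_rel G).
Proof.
split=> [x y xy c _|]; first exact: (congr_ple (con_congr c)).
split.
- exact: (pre_inhabited (pl_prelattice P)).
- split=> [x c _|x y z xy yz c Gc]; first exact: con_refl.
  by apply: con_trans (xy c Gc) (yz c Gc).
- move=> X a Xa; split=> [x Xx c Gc|b Xb c Gc]; first exact: (con_join c Xa).1.
  by have [_] := con_join c Xa; apply=> x Xx; exact: Xb.
- move=> X a Xa; split=> [x Xx c Gc|b Xb c Gc]; first exact: (con_meet c Xa).1.
  by have [_] := con_meet c Xa; apply=> x Xx; exact: Xb.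
Qed.

Definition con_gen (G : set (P * P)) : con P := Con (con_gen_congr G).

Lemma sub_con_gen G : G `<=` con_graph (con_gen G).
Proof. by move=> p Gp c; apply. Qed.

Lemma con_gen_min G (c : con P) : G `<=` con_graph c -> con_gen G <= c.
Proof. by move=> Gc; apply/con_leP=> x y; apply. Qed.

Lemma con_gen_sup (A : set (con P)) :
  supremums A (con_gen (\bigcup_(c in A) con_graph c)).
Proof.
split=> [c Ac|c cub].
  by apply/con_leP=> x y cxy; apply: (@sub_con_gen _ (x, y)); exists c.
by apply: con_gen_min => -[x y] [b Ab bxy]; apply: (con_leP _ _ (cub b Ab)).
Qed.

Definition con_fin_rel (A : set (con P)) (x y : P) : Prop :=
  exists F : set (con P), [/\ F `<=` A, finite_set F &
    con_gen (\bigcup_(c in F) con_graph c) x y].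

Lemma con_fin_all (A : set (con P)) (G : set (P * P)) : finite_set G ->
  (forall p, G p -> con_fin_rel A p.1 p.2) ->
  exists F : set (con P), [/\ F `<=` A, finite_set F &
    G `<=` con_graph (con_gen (\bigcup_(c in F) con_graph c))].
Proof.
move=> finG GA.
have /choice[F FP] : forall p : P * P, exists F : set (con P), G p ->
    [/\ F `<=` A, finite_set F &
        con_gen (\bigcup_(c in F) con_graph c) p.1 p.2].
  move=> p; have [/GA[F FP]|nG] := pselect (G p); first by exists F.
  by exists set0.
exists (\bigcup_(p in G) F p); split.
- by move=> c [p /FP[FA _ _]]; exact: FA.
- by apply: bigcup_finite => // p /FP[].
- move=> p Gp; have [_ _ Fp] := FP p Gp.
  by move=> c cF; apply: Fp => q [b Fb bq]; apply: cF; exists b => //; exists p.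
Qed.

Lemma con_fin_congr A : is_congruence (con_fin_rel A).
Proof.
split=> [x y xy|].
  by exists set0; split=> // c _; exact: (congr_ple (con_congr c)).
split.
- exact: (pre_inhabited (pl_prelattice P)).
- split=> [x|x y z xy yz].
    by exists set0; split=> // c _; exact: con_refl.
  have [||F [FA finF Fxyz]] := @con_fin_all A [set (x, y); (y, z)].
  + exact: finite_set2.
  + by move=> p [->|->].
  exists F; split=> //; apply: (@con_trans _ _ y).
    by apply: (Fxyz (x, y)); left.
  by apply: (Fxyz (y, z)); right.
- move=> X a Xa; split=> [x Xx|b Xb].
    by exists set0; split=> // c _; exact: (con_join c Xa).1.
  have [||F [FA finF FX]] := @con_fin_all A [set (x, b) | x in X].
  + by apply: finite_image; case: (op_domain Xa).
  + by move=> _ [x Xx <-]; exact: Xb.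
  exists F; split=> //.
  have [_] := con_join (con_gen (\bigcup_(c in F) con_graph c)) Xa; apply=> x Xx.
  by apply: (FX (x, b)); exists x.
- move=> X a Xa; split=> [x Xx|b Xb].
    by exists set0; split=> // c _; exact: (con_meet c Xa).1.
  have [||F [FA finF FX]] := @con_fin_all A [set (b, x) | x in X].
  + by apply: finite_image; case: (op_domain Xa).
  + by move=> _ [x Xx <-]; exact: Xb.
  exists F; split=> //.
  have [_] := con_meet (con_gen (\bigcup_(c in F) con_graph c)) Xa; apply=> x Xx.
  by apply: (FX (b, x)); exists x.
Qed.

Lemma con_gen_compact G : finite_set G -> compact_elt (con_gen G).
Proof.
move=> finG A s [sub slb] Gs.
have su : s <= Con (con_fin_congr A).
  apply: slb => c Ac; apply/con_leP=> x y cxy; exists [set c]; split=> //.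
    by move=> _ ->.
  by apply: (@sub_con_gen _ (x, y)); exists c.
have [|F [FA finF GF]] := @con_fin_all A G finG.
  move=> p Gp; apply: (con_leP _ _ su); apply: (con_leP _ _ Gs).
  exact: sub_con_gen.
exists F; split=> //; exists (con_gen (\bigcup_(c in F) con_graph c)).
  exact: con_gen_sup.
exact: con_gen_min.
Qed.

Lemma compact_con_gen (c : con P) : compact_elt c ->
  exists2 G : set (P * P), finite_set G & c = con_gen G.
Proof.
move=> cc; have [||F [FA finF [t [tub tlb] ct]]] :=
    cc [set con_gen [set p] | p in con_graph c] c.
- split=> [_ [p cp <-]|b bub]; first by apply: con_gen_min => _ ->.
  apply/con_leP=> x y cxy; have := bub (con_gen [set (x, y)]).
  by move=> /(_ (ex_intro2 _ _ (x, y) cxy erefl))/con_leP; apply; apply: (@sub_con_gen _ (x, y)).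
- exact: lexx.
have [p0 _] : exists p : P * P, True.
  by case: (pre_inhabited (pl_prelattice P)) => x; exists (x, x).
have /choice[g gP] : forall b : con P, exists p : P * P, F b ->
    con_graph c p /\ con_gen [set p] = b.
  move=> b; have [/FA[p cp <-]|nF] := pselect (F b); first by exists p.
  by exists p0.
exists (g @` F); first exact: finite_image.
apply/le_anti/andP; split; last first.
  by apply: con_gen_min => _ [b /gP[cg _] <-].
apply: le_trans ct _; apply: tlb => b Fb; rewrite -(gP b Fb).2.
by apply: con_gen_min => _ ->; apply: sub_con_gen; exists b.
Qed.

End ConOrder.

Record conc (P : partialLattice) : Type := Conc {
  conc_val :> con P;
  conc_valP : `[< compact_elt conc_val >] }.

HB.instance Definition _ (P : partialLattice) := [isSub for @conc_val P].
HB.instance Definition _ (P : partialLattice) := [Choice of conc P by <:].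
HB.instance Definition _ (P : partialLattice) :=
  [SubChoice_isSubPOrder of conc P by <: with con_display].

Section Conc.
Context (P : partialLattice).
Implicit Types a b c : conc P.

Lemma leE_conc a b : (a <= b) = (conc_val a <= conc_val b).
Proof. by []. Qed.

Fact conc_join_subproof a b :
  `[< compact_elt (con_gen (con_graph a `|` con_graph b)) >].
Proof.
apply/asboolP.
have [G finG aG] := compact_con_gen (asboolP _ (conc_valP a)).
have [H finH bH] := compact_con_gen (asboolP _ (conc_valP b)).
suff -> : con_gen (con_graph a `|` con_graph b) = con_gen (G `|` H).
  by apply: con_gen_compact; rewrite finite_setU.
apply/le_anti/andP; split; apply: con_gen_min => p.
- rewrite aG bH => -[] /= Gp c Gc; apply: Gp => q Gq; apply: Gc.
    by left.
  by right.
- move=> [Gp|Hp]; apply: sub_con_gen; [left|right].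
    by rewrite aG; exact: sub_con_gen.
  by rewrite bH; exact: sub_con_gen.
Qed.

Definition conc_join a b : conc P := Conc (conc_join_subproof a b).

Fact conc_leUx a b c : (conc_join a b <= c) = (a <= c) && (b <= c).
Proof.
rewrite !leE_conc /=; apply/idP/andP=> [/con_leP abc|[/con_leP ac /con_leP bc]].
  by split; apply/con_leP=> x y xy; apply: abc; apply: (@sub_con_gen _ _ (x, y));
    [left|right].
by apply: con_gen_min => -[x y] [/ac|/bc].
Qed.

HB.instance Definition _ :=
  @Order.POrder_isJoinSemilattice.Build con_display (conc P)
    conc_join conc_leUx.

Fact conc_bot_subproof : `[< compact_elt (con_gen (@set0 (P * P))) >].
Proof. exact/asboolP/con_gen_compact. Qed.

Definition conc_bot : conc P := Conc conc_bot_subproof.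

Fact conc_le0x a : conc_bot <= a.
Proof. by rewrite leE_conc; apply: con_gen_min. Qed.

HB.instance Definition _ :=
  @Order.hasBottom.Build con_display (conc P) conc_bot conc_le0x.

End Conc.

Section ConcMap.
Context (P Q : partialLattice) (f : plHom P Q).

Definition con_map (a : con P) : con Q :=
  con_gen [set (f p.1, f p.2) | p in con_graph a].

Fact con_pull_congr (c : con Q) : is_congruence (fun x y => c (f x) (f y)).
Proof.
split=> [x y xy|]; first exact: (congr_ple (con_congr c) (plhom_mono f xy)).
split.
- exact: (pre_inhabited (pl_prelattice P)).
- by split=> [x|x y z]; [exact: con_refl|exact: con_trans].
- move=> X a /(plhom_join f) Xa; split=> [x Xx|b Xb].
    by have [+ _] := con_join c Xa; apply; exists x.
  by have [_] := con_join c Xa; apply=> _ [x Xx <-]; exact: Xb.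
- move=> X a /(plhom_meet f) Xa; split=> [x Xx|b Xb].
    by have [+ _] := con_meet c Xa; apply; exists x.
  by have [_] := con_meet c Xa; apply=> _ [x Xx <-]; exact: Xb.
Qed.

Fact conc_map_subproof (a : conc P) : `[< compact_elt (con_map a) >].
Proof.
apply/asboolP.
have [G finG aG] := compact_con_gen (asboolP _ (conc_valP a)).
suff -> : con_map a = con_gen [set (f p.1, f p.2) | p in G].
  exact/con_gen_compact/finite_image.
apply/le_anti/andP; split; apply: con_gen_min => _ [p Gp <-].
  move: Gp; rewrite aG => Gp c Gc; apply: (Gp (Con (con_pull_congr c))) => q Gq.
  by apply: (Gc (f q.1, f q.2)); exists q.
by apply: sub_con_gen; exists p => //; rewrite aG; exact: sub_con_gen.
Qed.

Definition conc_map (a : conc P) : conc Q := Conc (conc_map_subproof a).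

End ConcMap.

Section LatticeNotions.
Context d (L : latticeType d).

Definition relatively_complemented : Prop :=
  forall a b x : L, a <= x <= b -> exists y : L, x `&` y = a /\ x `|` y = b.

Definition ideal (I : set L) : Prop :=
  [/\ I !=set0, (forall x y, I x -> I y -> I (x `|` y)) &
      (forall x y, x <= y -> I y -> I x)].

Definition lfilter (F : set L) : Prop :=
  [/\ F !=set0, (forall x y, F x -> F y -> F (x `&` y)) &
      (forall x y, x <= y -> F x -> F y)].

Definition convex_sublattice (C : set L) : Prop :=
  [/\ (forall x y, C x -> C y -> C (x `|` y)),
      (forall x y, C x -> C y -> C (x `&` y)) &
      (forall x y z, C x -> C z -> x <= y <= z -> C y)].

Definition generates_as (K : set L -> Prop) (G : set L) : Prop :=
  smallest K G = [set: L].

End LatticeNotions.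

Definition cofinal_in d (T : porderType d) (A : set T) : Prop :=
  forall s : T, exists2 a, A a & s <= a.

(* [K] is the kind of subset, ideals or filters, as which the range of [f] is
   required to generate [L]. *)
Definition good_lift (K : forall d (L : latticeType d), set L -> Prop)
    (P : partialLattice) d (S : bJoinSemilatticeType d) (phi : conc P -> S) : Prop :=
  exists (dL : Order.disp_t) (L : latticeType dL) (L0 : inhabited L)
    (f : plHom P (partial_of_lattice L0))
    (psi : conc (partial_of_lattice L0) -> S),
  [/\ relatively_complemented L,
      join0_isomorphism psi,
      phi = psi \o conc_map f,
      generates_as (K dL L) (range (f : P -> L)) &
      cofinal_in (range phi) ->
        generates_as (@convex_sublattice dL L) (range (f : P -> L))].

(* Main.v *)
(* The map phi turns P into an S-valued partial lattice: the value N x y of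
   "x <= y" is phi(Theta(x, y)), where Theta(x, y) is the least congruence
   containing (x, y); the value 0 means true, joins of S are conjunctions and
   meets are disjunctions. Given generators and relations that carry costs in S,
   let t <=_s u mean that t <= u is provable from the relations of cost at most
   s, and put N t u = inf {s | t <=_s u}. As S is conditionally co-Brouwerian,
   this infimum is again an S-valued lattice ordering. That it does not change
   the values of the generators is checked at each prime ideal I of S, where
   "N x y in I" is an ordinary partial prelattice, which embeds into the lattice
   of its ideals.

   Iterating omega times, adjoin freely, for x, y in an interval [b, a] and
   s, t in S, an element m of [b, a] with m v x = a and m ^ y = b such that
   a <= m has value at most s and m <= b has value at most t. In the limit L,
   these elements m serve as relative complements, as interpolants when
   N a b <= s v t, and as the axes of perspectivities. Together they show that
   (a, b) belongs to the congruence generated by finitely many pairs (c, e) as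
   soon as N a b is below the join of the values N c e, so that N induces an
   isomorphism from Con_c L onto S. If the range of phi is not cofinal in S, one
   also adds at the start, for each r in S, an element that is equal to a fixed
   p0 in P with value r and is otherwise below (or above) all of P. *)

Require Import Defs.
From HB Require Import structures.
From Stdlib Require Import List.
From mathcomp Require Import all_boot all_order.
From mathcomp Require Import boolp classical_sets cardinality.

Set Implicit Arguments.
Unset Strict Implicit.
Unset Printing Implicit Defensive.

Import Order.Theory.
Local Open Scope classical_set_scope.
Local Open Scope order_scope.

(** * Conditionally co-Brouwerian lattices *)

Section CoBrouwerian.
Context d (S : bLatticeType d).
Context (hS : conditionally_co_brouwerian S).
Implicit Types (x y z s v c : S) (A I : set S).

(** This is the infinite distributive law for the family {y, z}, read in the principal ideal of [t],
    which contains all elements involved. *)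
Lemma co_brouwerian_joinIr x y z : (x `|` y) `&` (x `|` z) <= x `|` (y `&` z).
Proof.
pose t := x `|` (y `|` z).
have xt : x <= t by exact: leUl.
have yt : y <= t by rewrite /t joinCA leUl.
have zt : z <= t by rewrite /t joinA leUr.
have yzt : y `&` z <= t by apply: le_trans (leIl _ _) yt.
pose i u (ut : u <= t) := PrincipalIdeal ut.
have [_ /(_ (i x xt) [set i y yt; i z zt] (i _ yzt))[]] := hS t.
  split=> [w [->|->]|w wyz]; rewrite leE_ideal /= ?leIl ?leIr //.
  by rewrite lexI; apply/andP; split; [apply: (wyz (i y yt)); left|
    apply: (wyz (i z zt)); right].
move=> _.
have wt : (x `|` y) `&` (x `|` z) <= t.
  by apply: le_trans (leIl _ _) _; rewrite leUx xt yt.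
by move=> /(_ (i _ wt)); apply=> _ [w [->|->] <-];
  rewrite leE_ideal /= ?leIl ?leIr.
Qed.

(** Replacing each x by x ^ a, for a fixed a in [A], moves [A] into a principal ideal without
    changing its lower bounds. The law for arbitrary [c] and [v] needs a larger ideal, whose infimum
    is then compared with [m]. *)
Lemma co_brouwerian_inf A : A !=set0 -> exists m,
  (forall x, A x -> m <= x) /\
  forall c v, (forall x, A x -> v <= c `|` x) -> v <= c `|` m.
Proof.
move=> [a Aa].
have main t : a <= t -> exists2 m, m <= t & (forall x, A x -> m <= x) /\
    forall c v, c <= t -> v <= t ->
      (forall x, A x -> v <= c `|` x) -> v <= c `|` m.
  move=> at_.
  have It x : x `&` a <= t by apply: le_trans (leIr _ _) at_.
  pose B := [set PrincipalIdeal (It x) | x in A].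
  have [cpl dist] := hS t.
  have [_ [[m mt] mB]] := cpl B.
  exists m => //; split=> [x Ax|c v ct vt vcA].
    have := mB.1 (PrincipalIdeal (It x)); rewrite leE_ideal /= => mx.
    apply: (le_trans (mx _)); last exact: leIl.
    by exists x.
  have [_ /(_ (PrincipalIdeal vt))] := dist (PrincipalIdeal ct) B _ mB.
  rewrite leE_ideal /=; apply=> _ [_ [x Ax <-] <-]; rewrite leE_ideal /=.
  apply: le_trans (co_brouwerian_joinIr _ _ _).
  by rewrite lexI !vcA.
have [m ma [mA mg]] := main a (lexx a).
exists m; split=> // c v vcA.
have [m' m't [m'A m'g]] := main (a `|` (c `|` v)) (leUl _ _).
have m'm : m' <= m.
  rewrite -[m]join0x; apply: mg => [||x Ax]; first exact: le0x.
    exact: m'A.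
  by rewrite join0x m'A.
suff vm' : v <= c `|` m' by apply: (le_trans vm'); rewrite leU2.
by apply: m'g => //; rewrite joinCA ?leUl // joinA leUr.
Qed.

Definition prime_ideal I :=
  [/\ I \bot, forall x y, x <= y -> I y -> I x,
      forall x y, I x -> I y -> I (x `|` y) &
      forall x y, I (x `&` y) -> I x \/ I y].

Lemma prime_idealU I x y : prime_ideal I -> I (x `|` y) <-> I x /\ I y.
Proof.
case=> _ Idn Ijn _; split=> [Ixy|[]]; last exact: Ijn.
by split; apply: Idn Ixy; [exact: leUl|exact: leUr].
Qed.

Lemma prime_idealI I x y : prime_ideal I -> I (x `&` y) <-> I x \/ I y.
Proof.
case=> _ Idn _ Ipr; split=> [|[]]; first exact: Ipr.
  by apply: Idn; exact: leIl.
by apply: Idn; exact: leIr.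
Qed.

(** Zorn's lemma gives a maximal ideal among those containing no x with v <= x v s; distributivity
    makes it prime. *)
Lemma prime_ideal_sep s v : ~ v <= s -> exists2 I, prime_ideal I & I s /\ ~ I v.
Proof.
move=> nvs.
(* The empty set satisfies [Q], so the union of an empty chain does too. That [s] and [\bot] belong
   to the maximal [I] follows from maximality. *)
pose Q I := [/\ forall x y, x <= y -> I y -> I x,
  forall x y, I x -> I y -> I (x `|` y) & forall x, I x -> ~ v <= x `|` s].
have [F FQ Ftot|I [[Idn Ijn Iv] Imax]] := @Zorn_bigcup S Q.
  split.
  - by move=> x y xy [A FA Ay]; exists A => //; have [+ _ _] := FQ A FA;
      apply; eauto.
  - move=> x y [A FA Ax] [B FB By].
    have [AB|BA] := Ftot A B FA FB.
      by exists B => //; have [_ + _] := FQ B FB; apply=> //; exact: AB.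
    by exists A => //; have [_ + _] := FQ A FA; apply=> //; exact: BA.
  - by move=> x [A FA Ax]; have [_ _] := FQ A FA; apply.
have Iout x : ~ I x -> exists2 y, I y \/ y = \bot & v <= x `|` y `|` s.
  move=> nIx; pose B := [set z | exists2 y, I y \/ y = \bot & z <= x `|` y].
  have IB : I `<` B.
    split; first by move=> y Iy; exists y; [left|exact: leUr].
    move=> BI; apply/nIx/BI; exists \bot; [by right|exact: leUl].
  apply: contrapT => nex; apply: (Imax B IB); split.
  - by move=> z z' zz' [y Iy z'y]; exists y => //; exact: le_trans z'y.
  - move=> z z' [y Iy zy] [y' Iy' zy']; exists (y `|` y').
      case: Iy Iy' => [Iy|->] [Iy'|->]; rewrite ?joinx0 ?join0x; auto.
    rewrite leUx (le_trans zy) ?(le_trans zy') // leU2 ?leUl ?leUr //.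
  - move=> z [y Iy zy] vz; apply: nex; exists y => //.
    by apply: (le_trans vz); rewrite leU2.
have Is : I s.
  apply: contrapT => /Iout[y [Iy|->]]; last by rewrite joinx0 joinxx.
  by rewrite joinAC joinxx joinC => /(Iv y Iy).
have I0 : I \bot by apply: Idn Is; exact: le0x.
exists I; last first.
  by split=> // Ivv; apply: (Iv _ Ivv); exact: leUl.
split=> // x y Ixy; have [Ix|nIx] := pselect (I x); first by left.
right; apply: contrapT => nIy.
have [x' Ix' vx] := Iout x nIx; have [y' Iy' vy] := Iout y nIy.
have {}Ix' : I x' by case: Ix' => [|->].
have {}Iy' : I y' by case: Iy' => [|->].
apply: (Iv (x `&` y `|` (x' `|` y'))); first by auto.
rewrite -joinA joinC; apply: le_trans (co_brouwerian_joinIr _ _ _).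
rewrite lexI (le_trans vx) ?(le_trans vy) //.
- by rewrite -joinA joinC leU2 // leU2 ?leUr.
- by rewrite -joinA joinC leU2 // leU2 ?leUl.
Qed.

Lemma prime_ideal_le s v :
  (forall I, prime_ideal I -> I s -> I v) -> v <= s.
Proof.
move=> H; apply: contrapT => /prime_ideal_sep[I Ip [Is]]; apply.
exact: H.
Qed.

End CoBrouwerian.

(** * Lattice terms over S-valued relations *)

(* [vN x y] is the truth value of [x <= y]: [\bot] is true, joins of [S] are
   conjunctions and meets are disjunctions. *)
Record vlattice d (S : bLatticeType d) : Type := VLattice {
  vcar :> Type;
  vN : vcar -> vcar -> S;
  vJ : vcar -> vcar -> vcar;
  vM : vcar -> vcar -> vcar;
  vNxx : forall x, vN x x = \bot;
  vN_trans : forall x y z, vN x z <= vN x y `|` vN y z;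
  vNJl : forall x y, vN x (vJ x y) = \bot;
  vNJr : forall x y, vN y (vJ x y) = \bot;
  vNJ : forall x y z, vN (vJ x y) z <= vN x z `|` vN y z;
  vNMl : forall x y, vN (vM x y) x = \bot;
  vNMr : forall x y, vN (vM x y) y = \bot;
  vNM : forall x y z, vN z (vM x y) <= vN z x `|` vN z y }.

Arguments vN {d S v}.
Arguments vJ {d S v}.
Arguments vM {d S v}.

Section VLatticeTheory.
Context d (S : bLatticeType d) (V : vlattice S).
Implicit Types (x y z u v : V).

Definition veqv x y := vN x y = \bot /\ vN y x = \bot.

Lemma veqv_refl x : veqv x x. Proof. by split; rewrite vNxx. Qed.

Lemma veqv_sym x y : veqv x y -> veqv y x. Proof. by case. Qed.

Lemma vN_trans0 x y z : vN x y = \bot -> vN y z = \bot -> vN x z = \bot.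
Proof.
move=> xy yz; apply/eqP; rewrite -lex0; apply: le_trans (vN_trans x y z) _.
by rewrite xy yz joinxx.
Qed.

Lemma veqv_trans x y z : veqv x y -> veqv y z -> veqv x z.
Proof. by move=> [xy yx] [yz zy]; split; apply: vN_trans0; eauto. Qed.

Lemma vN_mono x x' y y' :
  vN x' x = \bot -> vN y y' = \bot -> vN x' y' <= vN x y.
Proof.
move=> xx' yy'; apply: le_trans (vN_trans _ x _) _; rewrite xx' join0x.
by apply: le_trans (vN_trans _ y _) _; rewrite yy' joinx0.
Qed.

Lemma vN_eqv x x' y y' : veqv x x' -> veqv y y' -> vN x y = vN x' y'.
Proof.
by move=> [xx' x'x] [yy' y'y]; apply/le_anti/andP; split; apply: vN_mono.
Qed.

Lemma vNJE x y z : vN (vJ x y) z = vN x z `|` vN y z.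
Proof.
apply/le_anti/andP; split; first exact: vNJ.
by rewrite leUx !vN_mono ?vNJl ?vNJr ?vNxx.
Qed.

Lemma vNME x y z : vN z (vM x y) = vN z x `|` vN z y.
Proof.
apply/le_anti/andP; split; first exact: vNM.
by rewrite leUx !vN_mono ?vNMl ?vNMr ?vNxx.
Qed.

Lemma vJ_eqv x x' y y' : veqv x x' -> veqv y y' -> veqv (vJ x y) (vJ x' y').
Proof.
move=> xx' yy'; split; rewrite vNJE.
  by rewrite (vN_eqv xx' (veqv_refl _)) (vN_eqv yy' (veqv_refl _)) vNJl vNJr
    joinxx.
rewrite (vN_eqv (veqv_sym xx') (veqv_refl _)).
by rewrite (vN_eqv (veqv_sym yy') (veqv_refl _)) vNJl vNJr joinxx.
Qed.

Lemma vM_eqv x x' y y' : veqv x x' -> veqv y y' -> veqv (vM x y) (vM x' y').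
Proof.
move=> xx' yy'; split; rewrite vNME.
  rewrite (vN_eqv (veqv_refl _) (veqv_sym xx')).
  by rewrite (vN_eqv (veqv_refl _) (veqv_sym yy')) vNMl vNMr joinxx.
by rewrite (vN_eqv (veqv_refl _) xx') (vN_eqv (veqv_refl _) yy') vNMl vNMr
  joinxx.
Qed.

End VLatticeTheory.

(** * Free lattices with costs, and their conservativity *)

Section FreeLattice.
Context d (S : bLatticeType d) (hS : conditionally_co_brouwerian S).
Context (X : Type) (R : S -> X -> X -> Prop) (JX MX : set X -> X -> Prop).

Inductive term : Type :=
| tgen of X
| tjoin of term & term
| tmeet of term & term.

Inductive prov (s : S) : term -> term -> Prop :=
| prov_gen s' x y : s' <= s -> R s' x y -> prov s (tgen x) (tgen y)
| prov_refl t : prov s t t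
| prov_trans t u v : prov s t u -> prov s u v -> prov s t v
| prov_joinl t u : prov s t (tjoin t u)
| prov_joinr t u : prov s u (tjoin t u)
| prov_join t u v : prov s t v -> prov s u v -> prov s (tjoin t u) v
| prov_meetl t u : prov s (tmeet t u) t
| prov_meetr t u : prov s (tmeet t u) u
| prov_meet t u v : prov s v t -> prov s v u -> prov s v (tmeet t u)
| prov_ub A a x : JX A a -> A x -> prov s (tgen x) (tgen a)
| prov_lub A a t : JX A a -> (forall x, A x -> prov s (tgen x) t) ->
    prov s (tgen a) t
| prov_lb A a x : MX A a -> A x -> prov s (tgen a) (tgen x)
| prov_glb A a t : MX A a -> (forall x, A x -> prov s t (tgen x)) ->
    prov s t (tgen a).

Lemma prov_mono s s' t u : s <= s' -> prov s t u -> prov s' t u.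
Proof.
move=> ss'; elim=> [s'' x y s''s||||||||||||]; try by econstructor; eauto.
move=> xy; apply: prov_gen xy; exact: le_trans ss'.
Qed.

Context (Rconn : forall x y, exists s, prov s (tgen x) (tgen y)).

(** [S] may lack a top, so the infimum [free_N] requires a nonempty set of costs for each pair of
    terms. *)
Lemma prov_ex t u : exists s, prov s t u.
Proof.
elim: t u => [x|t1 IH1 t2 IH2|t1 IH1 t2 IH2] u.
- elim: u => [y|u1 [s1 H1] u2 _|u1 [s1 H1] u2 [s2 H2]]; first exact: Rconn.
    by exists s1; apply: prov_trans H1 _; constructor.
  by exists (s1 `|` s2); apply: prov_meet;
    [apply: prov_mono H1; exact: leUl|apply: prov_mono H2; exact: leUr].
- have [s1 H1] := IH1 u; have [s2 H2] := IH2 u.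
  by exists (s1 `|` s2); apply: prov_join;
    [apply: prov_mono H1; exact: leUl|apply: prov_mono H2; exact: leUr].
- have [s1 H1] := IH1 u; exists s1.
  by apply: prov_trans H1; constructor.
Qed.

(** The infimum is chosen together with the distributive law of [co_brouwerian_inf]; by [prov_ex]
    the default [\bot] never serves as a fallback. *)
Definition free_N t u : S := xget \bot [set m | (forall s, prov s t u -> m <=
  s) /\
  forall c v, (forall s, prov s t u -> v <= c `|` s) -> v <= c `|` m].

Lemma free_NP t u : (forall s, prov s t u -> free_N t u <= s) /\
  forall c v, (forall s, prov s t u -> v <= c `|` s) -> v <= c `|` free_N t u.
Proof.
have [s stu] := prov_ex t u.
have [|m mP] := co_brouwerian_inf hS (A := [set s | prov s t u]);
  first by exists s.
exact: (@xgetPex _ \bot [set m | (forall s, prov s t u -> m <= s) /\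
  forall c v, (forall s, prov s t u -> v <= c `|` s) -> v <= c `|` m]
  (ex_intro _ m mP)).
Qed.

Lemma free_N_le s t u : prov s t u -> free_N t u <= s.
Proof. exact: (free_NP t u).1. Qed.

Lemma free_N0 t u : prov \bot t u -> free_N t u = \bot.
Proof. by move=> /free_N_le; rewrite lex0 => /eqP. Qed.

Lemma free_N_ge c v t u : (forall s, prov s t u -> v <= c `|` s) ->
  v <= c `|` free_N t u.
Proof. exact: (free_NP t u).2. Qed.

(** Both premises can be raised to a common cost, so a rule of [prov] with two premises yields the
    matching inequality between infima. *)
Lemma free_N_ge2 v t u t' u' :
  (forall s, prov s t u -> prov s t' u' -> v <= s) ->
  v <= free_N t u `|` free_N t' u'.
Proof.
move=> H; apply: free_N_ge => s' H'; rewrite joinC; apply: free_N_ge => s H''.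
by apply: H; [apply: prov_mono H''; exact: leUr|apply: prov_mono H';
  exact: leUl].
Qed.

Definition free_vlattice : vlattice S.
Proof.
refine (@VLattice _ S term free_N tjoin tmeet _ _ _ _ _ _ _ _).
- by move=> t; apply: free_N0; constructor.
- move=> t u v; apply: free_N_ge2 => s H1 H2; apply: free_N_le.
  exact: prov_trans H1 H2.
- by move=> t u; apply: free_N0; constructor.
- by move=> t u; apply: free_N0; constructor.
- by move=> t u v; apply: free_N_ge2 => s H1 H2; apply: free_N_le; constructor.
- by move=> t u; apply: free_N0; constructor.
- by move=> t u; apply: free_N0; constructor.
- by move=> t u v; apply: free_N_ge2 => s H1 H2; apply: free_N_le; constructor.
Defined.

Record adapted (I : set S) (r : X -> X -> Prop) : Prop := Adapted {
  ad_refl : forall x, r x x;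
  ad_trans : forall x y z, r x y -> r y z -> r x z;
  ad_gen : forall s x y, I s -> R s x y -> r x y;
  ad_join : forall A a, JX A a -> rel_sup r A a;
  ad_meet : forall A a, MX A a -> rel_inf r A a }.

Definition rideal (r : X -> X -> Prop) (D : set X) : Prop :=
  (forall x y, r x y -> D y -> D x) /\ forall A a, JX A a -> A `<=` D -> D a.

(** Evaluation in the complete lattice of [rideal] sets; the quantification over [D] gives the ideal
    generated by the two values. *)
Fixpoint interp r t : set X :=
  match t with
  | tgen x => [set z | r z x]
  | tjoin t u => [set z | forall D, rideal r D -> interp r t `<=` D ->
      interp r u `<=` D -> D z]
  | tmeet t u => interp r t `&` interp r u
  end.

Lemma interp_rideal I r t : adapted I r -> rideal r (interp r t).
Proof.
move=> [rr rt _ rj _]; elim: t => [x|t [d1 j1] u [d2 j2]|t [d1 j1] u [d2 j2]]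
  /=.
- split=> [y z yz zx|A a Aa Ax]; first exact: rt yz zx.
  exact: (rj A a Aa).2.
- split=> [y z yz H D Di tD uD|A a Aa AH D Di tD uD].
    by apply: (Di.1 _ _ yz); exact: H.
  by apply: (Di.2 _ _ Aa) => x /AH; apply.
- split=> [y z yz [zt zu]|A a Aa AH]; first by split; eauto.
  by split; [apply: (j1 A)|apply: (j2 A)] => // x /AH[].
Qed.

(** Soundness of [prov] in the ideal model. Prescribed joins are respected because ideals are closed
    under [JX], prescribed meets because the principal ideal of an infimum is the intersection of
    the principal ideals. *)
Lemma prov_interp I r s t u : prime_ideal I -> adapted I r -> I s ->
  prov s t u -> interp r t `<=` interp r u.
Proof.
move=> [_ Idn _ _] ad Is; have [rr rt rg rj rm] := ad.
elim=> /=.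
- move=> s' x y s's xy z zx; apply: rt zx _; apply: rg xy.
  exact: Idn Is.
- by move=> t'.
- by move=> t' u' v _ tu _ uv z /tu/uv.
- by move=> t' u' z zt D _ tD _; exact: tD.
- by move=> t' u' z zu D _ _; apply.
- move=> t' u' v _ tv _ uv z; apply=> //; exact: interp_rideal ad.
- by move=> t' u' z [].
- by move=> t' u' z [].
- by move=> t' u' v _ vt _ vu z zv; split; [exact: vt|exact: vu].
- move=> A a x Aa Ax z zx; apply: rt zx _; exact: (rj A a Aa).1.
- move=> A a t' Aa _ At z za.
  apply: (interp_rideal t' ad).1 za _.
  apply: (interp_rideal t' ad).2 Aa _ => x Ax.
  exact: (At x Ax x).
- move=> A a x Aa Ax z za; apply: rt za _; exact: (rm A a Aa).1.
- move=> A a t' Aa _ At z zt.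
  by apply: (rm A a Aa).2 => x Ax; exact: (At x Ax z).
Qed.

(** If x <= y has a proof of cost s in [I], soundness puts x into the principal ideal of y, so r x y
    holds and v is in [I]. As prime ideals separate elements, v <= s for each such cost. *)
Lemma free_N_conservative v x y :
  (forall I, prime_ideal I -> exists2 r, adapted I r & r x y -> I v) ->
  v <= free_N (tgen x) (tgen y).
Proof.
move=> H; rewrite -[free_N _ _]join0x; apply: free_N_ge => s sxy.
rewrite join0x; apply: (prime_ideal_le hS) => I Ip Is.
have [r ad] := H I Ip; apply.
have /= := prov_interp Ip ad Is sxy; apply; exact: ad_refl ad x.
Qed.

End FreeLattice.

Arguments prov_gen {d S X R JX MX s s' x y}.
Arguments prov_ub {d S X R JX MX s A a x}.
Arguments prov_lub {d S X R JX MX s A a t}.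
Arguments prov_lb {d S X R JX MX s A a x}.
Arguments prov_glb {d S X R JX MX s A a t}.

(** * Adjoining one layer of solutions *)

Section OneStep.
Context d (S : bLatticeType d) (hS : conditionally_co_brouwerian S).

(* [s] and [t] are the truth values under which a solution [m] must be [a],
   respectively [b]; where neither holds, [m] is a new element of [[b, a]]. The
   inequalities ensure that [m] can be chosen with [m v x = a] and
   [m ^ y = b] without identifying anything in [V]. *)
Record solvable (V : vlattice S) (a b x y : V) (s t : S) : Prop := Solvable {
  solv_ba : vN b a = \bot;
  solv_xa : vN x a = \bot;
  solv_by : vN b y = \bot;
  solv_ab : vN a b <= s `|` t;
  solv_ax : vN a x <= t;
  solv_xb : s `&` vN a b <= vN x b;
  solv_yb : vN y b <= s;
  solv_ay : t `&` vN a b <= vN a y }.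

(** By [sol_bm] and transitivity vN a m <= vN a b, so [sol_am] and [sol_amge] make the value of a <=
    m exactly s ^ vN a b. This exactness later gives surjectivity onto [S]. *)
Record solution (V : vlattice S) (a b x y : V) (s t : S) (m : V) : Prop :=
  Solution {
  sol_bm : vN b m = \bot;
  sol_ma : vN m a = \bot;
  sol_am : vN a m <= s;
  sol_mb : vN m b <= t;
  sol_amge : s `&` vN a b <= vN a m;
  sol_join : vN a (vJ m x) = \bot;
  sol_meet : vN (vM m y) b = \bot }.

Context (V : vlattice S).

Record problem : Type := Problem {
  pa : V; pb : V; px : V; py : V; ps : S; pt : S;
  pP : solvable pa pb px py ps pt }.

Definition step_gen : Type := (V + problem)%type.

Inductive step_rel (s : S) : step_gen -> step_gen -> Prop :=
| step_base q q' : vN q q' <= s -> step_rel s (inl q) (inl q')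
| step_lb p : step_rel s (inl (pb p)) (inr p)
| step_ub p : step_rel s (inr p) (inl (pa p))
| step_s p : ps p <= s -> step_rel s (inl (pa p)) (inr p)
| step_t p : pt p <= s -> step_rel s (inr p) (inl (pb p)).

Inductive step_join : set step_gen -> step_gen -> Prop :=
| step_joinV q q' : step_join [set inl q; inl q'] (inl (vJ q q'))
| step_joinP p : step_join [set inr p; inl (px p)] (inl (pa p)).

Inductive step_meet : set step_gen -> step_gen -> Prop :=
| step_meetV q q' : step_meet [set inl q; inl q'] (inl (vM q q'))
| step_meetP p : step_meet [set inr p; inl (py p)] (inl (pb p)).

Lemma step_conn x y : exists s, prov step_rel step_join step_meet s (tgen x)
  (tgen y).
Proof.
have up x' : exists q, forall s, prov step_rel step_join step_meet s (tgen x')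
  (tgen (inl q)).
  by case: x' => [q|p]; [exists q|exists (pa p)] => s;
    [exact: prov_refl|apply: (prov_gen (lexx s)); constructor].
have dn y' : exists q, forall s, prov step_rel step_join step_meet s (tgen (inl
  q)) (tgen y').
  by case: y' => [q|p]; [exists q|exists (pb p)] => s;
    [exact: prov_refl|apply: (prov_gen (lexx s)); constructor].
have [q Hq] := up x; have [q' Hq'] := dn y.
exists (vN q q'); apply: prov_trans (Hq _) _; apply: prov_trans (Hq' _).
by apply: (prov_gen (lexx _)); constructor.
Qed.

Definition step : vlattice S := free_vlattice hS step_conn.
Definition step_emb (q : V) : step := tgen (inl q).

Section Model.
Context (I : set S) (Ip : prime_ideal I).

Let le (x y : V) : Prop := I (vN x y).
(** [lo] and [hi] read q <= m and m <= q at [I], for the new element m of p: it lies in [b, a], is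
    above a once s is in [I], and is below b once t is in [I]. *)
Let lo (p : problem) q : Prop := le q (pb p) \/ (I (ps p) /\ le q (pa p)).
Let hi (p : problem) q : Prop := le (pa p) q \/ (I (pt p) /\ le (pb p) q).

(* Two distinct new elements are comparable only through an element of [V]. *)
Definition step_model (u v : step_gen) : Prop :=
  match u, v with
  | inl q, inl q' => le q q'
  | inl q, inr p => lo p q
  | inr p, inl q => hi p q
  | inr p, inr p' => p = p' \/ exists2 q, hi p q & lo p' q
  end.

Let I0 : I \bot. Proof. by case: Ip. Qed.
Let Idn x y : x <= y -> I y -> I x. Proof. by case: Ip => _ + _ _; apply. Qed.
Let IU x y : I (x `|` y) <-> I x /\ I y. Proof. exact: prime_idealU. Qed.
Let II x y : I (x `&` y) <-> I x \/ I y. Proof. exact: prime_idealI. Qed.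
Let le_refl x : le x x. Proof. by rewrite /le vNxx. Qed.
Let le0 x y : vN x y = \bot -> le x y. Proof. by rewrite /le => ->. Qed.
Let le_trans' x y z : le x y -> le y z -> le x z.
Proof. by move=> xy yz; apply: Idn (vN_trans x y z) _; apply/IU. Qed.

Let lo_dn p q q' : le q q' -> lo p q' -> lo p q.
Proof. by move=> qq' [?|[??]]; [left|right; split=> //];
  apply: le_trans' qq' _. Qed.

Let hi_up p q q' : le q q' -> hi p q -> hi p q'.
Proof. by move=> qq' [H|[? H]]; [left|right; split=> //];
  apply: le_trans' H qq'. Qed.

(** Passing through a new element creates no inequality in [V]: if s and t are both in [I], then
    [solv_ab] already gives a <= b. *)
Let lo_hi p q q' : lo p q -> hi p q' -> le q q'.
Proof.
have [/le0 ba _ _ /Idn abst _ _ _ _] := pP p.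
move=> [qb|[Is qa]] [aq|[It bq]].
- exact: le_trans' qb (le_trans' ba aq).
- exact: le_trans' qb bq.
- exact: le_trans' qa aq.
- by apply: le_trans' qa (le_trans' _ bq); apply: abst; apply/IU.
Qed.

(** [solv_ax] and [solv_xb] make a the join of m and x; [solv_yb] and [solv_ay] make b the meet of m
    and y. *)
Lemma step_adapted : adapted step_rel step_join step_meet I step_model.
Proof.
split.
- by case=> [q|p] /=; [exact: le_refl|left].
- move=> [x|p] [y|p'] [z|p''] //=.
  + exact: le_trans'.
  + exact: lo_dn.
  + exact: lo_hi.
  + move=> Lx [<- //|[q hq lq]]; exact: lo_dn (lo_hi Lx hq) lq.
  + by move=> hy yz; exact: hi_up yz hy.
  + by move=> hy ly; right; exists y.
  + move=> [-> //|[q hq lq]] hz; exact: hi_up (lo_hi lq hz) hq.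
  + move=> [->//|[q hq lq]] [<-|[q' hq' lq']]; right; first by exists q.
    exists q' => //; exact: hi_up (lo_hi lq hq') hq.
- move=> s x y Is; case=> /= [q q' qq'|p|p|p sp|p tp].
  + exact: Idn Is.
  + by left; exact: le_refl.
  + by left; exact: le_refl.
  + by right; split; [exact: Idn Is|exact: le_refl].
  + by right; split; [exact: Idn Is|exact: le_refl].
- move=> _ _ [q q'|p].
    split=> [_ [->|->] /=|]; rewrite ?/le ?vNJl ?vNJr //.
    move=> [u|p] H; have /= := H (inl q) (or_introl erefl);
      have /= := H (inl q') (or_intror erefl).
      by move=> q'u qu; apply: Idn (vNJ _ _ _) _; apply/IU.
    have /le0 ba := solv_ba (pP p).
    have jn r : le q r -> le q' r -> le (vJ q q') r.
      by move=> qu q'u; apply: Idn (vNJ _ _ _) _; apply/IU.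
    move=> [q'b|[Is q'a]] [qb|[Is' qa]]; rewrite /lo.
    * by left; apply: jn.
    * by right; split=> //; apply: jn => //; exact: le_trans' q'b ba.
    * by right; split=> //; apply: jn => //; exact: le_trans' qb ba.
    * by right; split=> //; apply: jn.
  have [_ /le0 xa _ _ /Idn axt /Idn sxb _ _] := pP p.
  split=> [_ [->|->] /=|]; [by left; exact: le_refl|exact: xa|].
  have hix q : hi p q -> le (px p) q -> le (pa p) q.
    by move=> [//|[It _]] xq; apply: le_trans' xq; exact: axt.
  move=> [u|p'] H; have /= := H (inr p) (or_introl erefl);
    have /= := H (inl (px p)) (or_intror erefl).
    by move=> xu pu; exact: hix.
  move=> xp' [e|[q hq lq]].
    subst p'; case: xp' => [xb|[Is _]]; last by right; split=> //;
      exact: le_refl.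
    (* Primeness of [I] applied to s ^ vN a b: either a <= m because s is in [I], or a <= b already
       holds. *)
    by have /II[Is|ab] := sxb xb; [right|left].
  case: hq => [aq|[It _]]; first exact: lo_dn lq.
  by apply: lo_dn xp'; exact: axt.
- move=> _ _ [q q'|p].
    split=> [_ [->|->] /=|]; rewrite ?/le ?vNMl ?vNMr //.
    move=> [u|p] H; have /= := H (inl q) (or_introl erefl);
      have /= := H (inl q') (or_intror erefl).
      by move=> q'u qu; apply: Idn (vNM _ _ _) _; apply/IU.
    have /le0 ba := solv_ba (pP p).
    have jn r : le r q -> le r q' -> le r (vM q q').
      by move=> qu q'u; apply: Idn (vNM _ _ _) _; apply/IU.
    move=> [q'b|[Is q'a]] [qb|[Is' qa]]; rewrite /hi.
    * by left; apply: jn.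
    * by right; split=> //; apply: jn => //; exact: le_trans' q'b.
    * by right; split=> //; apply: jn => //; exact: le_trans' qb.
    * by right; split=> //; apply: jn.
  have [_ _ /le0 by_ _ _ _ /Idn ybs /Idn tay] := pP p.
  split=> [_ [->|->] /=|]; [by left; exact: le_refl|exact: by_|].
  have loy q : lo p q -> le q (py p) -> le q (pb p).
    by move=> [//|[Is _]] qy; apply: (le_trans' qy); exact: ybs.
  move=> [u|p'] H; have /= := H (inr p) (or_introl erefl);
    have /= := H (inl (py p)) (or_intror erefl).
    by move=> xu pu; exact: loy.
  move=> yp' [e|[q hq lq]].
    subst p'; case: yp' => [ay|[It _]]; last by right; split=> //;
      exact: le_refl.
    by have /II[It|ab] := tay ay; [right|left].
  case: lq => [qb|[Is _]]; first exact: hi_up hq.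
  by apply: hi_up yp'; exact: ybs.
Qed.

End Model.

Lemma step_embN q q' : vN (step_emb q) (step_emb q') = vN q q'.
Proof.
apply/le_anti/andP; split.
  by apply: (free_N_le hS step_conn); apply: (prov_gen (lexx _)); constructor.
by apply: (free_N_conservative hS step_conn) => I Ip;
  exists (step_model I) => //; exact: step_adapted.
Qed.

Lemma step_embJ q q' :
  veqv (step_emb (vJ q q')) (vJ (step_emb q) (step_emb q')).
Proof.
split; apply: (free_N0 hS step_conn).
  apply: (prov_lub (step_joinV q q')) => _ [->|->]; constructor.
by apply: prov_join; apply: (prov_ub (step_joinV q q')); [left|right].
Qed.

Lemma step_embM q q' :
  veqv (step_emb (vM q q')) (vM (step_emb q) (step_emb q')).
Proof.
split; apply: (free_N0 hS step_conn).
  by apply: prov_meet; apply: (prov_lb (step_meetV q q')); [left|right].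
apply: (prov_glb (step_meetV q q')) => _ [->|->]; constructor.
Qed.

Lemma step_solve a b x y s t : solvable a b x y s t ->
  exists m : step, solution (step_emb a) (step_emb b) (step_emb x) (step_emb y)
    s t m.
Proof.
move=> H; pose p := Problem H; exists (tgen (inr p)).
split.
- by apply: (free_N0 hS step_conn); apply: (prov_gen (lexx _));
    exact: (step_lb _ p).
- by apply: (free_N0 hS step_conn); apply: (prov_gen (lexx _));
    exact: (step_ub _ p).
- by apply: (free_N_le hS step_conn); apply: (prov_gen (lexx _));
    exact: (step_s (p := p)).
- by apply: (free_N_le hS step_conn); apply: (prov_gen (lexx _));
    exact: (step_t (p := p)).
(* At [I], a <= m means that a <= b or s is in [I]; either one puts s ^ vN a b into [I]. *)
- rewrite step_embN; apply: (free_N_conservative hS step_conn) => I Ip.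
  exists (step_model I); first exact: step_adapted.
  by move=> [ab|[Is _]]; apply/prime_idealI; auto.
- apply: (free_N0 hS step_conn); apply: (prov_lub (step_joinP p)) => _ [->|->];
    constructor.
- apply: (free_N0 hS step_conn); apply: (prov_glb (step_meetP p)) => _ [->|->];
    constructor.
Qed.

End OneStep.

(** * The S-valued partial lattice of a map from Con_c P *)

Lemma finite_set_list (T : Type) (A : set T) : finite_set A ->
  exists l : seq T, forall x, A x <-> List.In x l.
Proof.
move=> /(@finite_seqP {classic T})[l ->]; exists l => x /=.
elim: l => [|y l IHl] /=; first by rewrite in_nil; split.
rewrite inE -IHl; split; first by move=> /orP[/eqP->|]; auto.
by move=> [->|->]; rewrite ?eqxx ?orbT.
Qed.

Fixpoint vbigJ d (S : bLatticeType d) (V : vlattice S) (x : V) (l : seq V) : V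
  :=
  if l is y :: l' then vJ x (vbigJ y l') else x.

Fixpoint vbigM d (S : bLatticeType d) (V : vlattice S) (x : V) (l : seq V) : V
  :=
  if l is y :: l' then vM x (vbigM y l') else x.

Section ConcGenerators.
Context (P : partialLattice).

Definition conc_pair (x y : P) : conc P :=
  Conc (asboolT (con_gen_compact (finite_set1 (x, y)))).

Lemma conc_pairP x y : conc_pair x y x y.
Proof. by apply: (@sub_con_gen _ _ (x, y)). Qed.

Lemma conc_pair_le x y (c : con P) : c x y -> conc_val (conc_pair x y) <= c.
Proof. by move=> cxy; apply: con_gen_min => _ ->. Qed.

Definition conc_list (l : seq (P * P)) : conc P :=
  foldr (fun p c => conc_pair p.1 p.2 `|` c) \bot l.

Lemma conc_listP l p : List.In p l -> conc_list l p.1 p.2.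
Proof.
elim: l => [//|q l IHl] [->|/IHl H].
  have /con_leP := leUl (conc_pair p.1 p.2) (conc_list l).
  by apply; exact: conc_pairP.
by have /con_leP le_l := leUr (conc_list l) (conc_pair q.1 q.2); exact: le_l H.
Qed.

Lemma conc_le_list (c : conc P) (G : set (P * P)) (l : seq (P * P)) :
  (forall p, G p -> List.In p l) -> (forall x y, c x y -> con_gen G x y) ->
  c <= conc_list l.
Proof.
move=> Gl cG; apply/con_leP => x y /cG H; apply: (H (conc_val _)) => p /Gl;
  exact: conc_listP.
Qed.

End ConcGenerators.

Section SemilatticeValues.
Context d (S : bLatticeType d) (P : partialLattice) (phi : conc P -> S).
Context (phiM : join0_morphism phi).

Lemma join0_morphism_mono a b : a <= b -> phi a <= phi b.
Proof. by move=> /join_r <-; rewrite phiM.2 leUl. Qed.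

Definition phiN (x y : P) : S := phi (conc_pair x y).

Lemma phiN0 x y : ple x y -> phiN x y = \bot.
Proof.
move=> xy; apply/eqP; rewrite -lex0 -phiM.1; apply: join0_morphism_mono.
by apply: conc_pair_le; exact: (congr_ple (con_congr _)).
Qed.

(** The finite [G] bounds c by a finite join of principal congruences, which [phi] sends to a join
    of members of [I]. This serves for prime ideals and for principal ideals of [S]. *)
Lemma phi_ideal (I : set S) (c : conc P) (G : set (P * P)) :
  I \bot -> (forall x y, x <= y -> I y -> I x) ->
  (forall x y, I x -> I y -> I (x `|` y)) -> finite_set G ->
  (forall x y, c x y -> con_gen G x y) ->
  (forall p, G p -> I (phiN p.1 p.2)) -> I (phi c).
Proof.
move=> I0 Idn Ij /finite_set_list[l Gl] cG GI.
apply: (Idn _ (phi (conc_list l))).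
  by apply/join0_morphism_mono/(conc_le_list _ cG) => p /Gl.
have {cG} : forall p, List.In p l -> I (phiN p.1 p.2) by move=> p /Gl/GI.
elim: l {Gl} => [|p l IHl] H /=; first by rewrite phiM.1.
rewrite phiM.2; apply: Ij; first by apply: H; left.
by apply: IHl => q ql; apply: H; right.
Qed.

Lemma phi_le (c : conc P) s :
  phi c <= s <-> forall x y, c x y -> phiN x y <= s.
Proof.
split=> [cs x y cxy|H].
  by apply: le_trans cs; apply: join0_morphism_mono; exact: conc_pair_le.
have [G finG cG] := compact_con_gen (asboolP _ (conc_valP c)).
apply: (@phi_ideal [set u | u <= s] c G _ _ _ finG); first exact: le0x.
- by move=> x y xy; exact: le_trans.
- by move=> x y /= xs ys; rewrite leUx xs ys.
- by move=> x y; rewrite cG.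
- by move=> [x y] Gp; apply: H; rewrite cG; exact: (@sub_con_gen _ _ (x, y)).
Qed.

Context (I : set S) (Ip : prime_ideal I).

(** Transitivity and the extremality of joins and meets say that a pair lies in a congruence
    generated by finitely many pairs with values in [I]; prescribed joins and meets have finite
    domains. *)
Lemma phiN_prelattice :
  is_partial_prelattice (fun x y => I (phiN x y)) (@pjoin P) (@pmeet P).
Proof.
have [I0 Idn Ij _] := Ip.
have key x y (G : set (P * P)) : finite_set G -> con_gen G x y ->
    (forall p, G p -> I (phiN p.1 p.2)) -> I (phiN x y).
  move=> finG Gxy; apply: phi_ideal => // u v; apply/con_leP.
  exact: conc_pair_le.
split.
- exact: (pre_inhabited (pl_prelattice P)).
- split=> [x|x y z xy yz].
    by rewrite phiN0 //; case: (pre_preorder (pl_prelattice P)).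
  apply: (key x z [set (x, y); (y, z)]); first exact: finite_set2.
    by move=> c cG; apply: (@con_trans _ _ _ y);
      [apply: (cG (x, y)); left|apply: (cG (y, z)); right].
  by move=> _ [->|->].
- move=> X a Xa; split=> [x Xx|b Xb].
    by rewrite phiN0 //; exact: (pre_join_sup (pl_prelattice P) Xa).1.
  apply: (key a b [set (x, b) | x in X]).
  + by apply: finite_image; case: (op_domain Xa).
  + move=> c cG; apply: (con_join c Xa).2 => x Xx; apply: (cG (x, b)).
    by exists x.
  + by move=> _ [x Xx <-]; exact: Xb.
- move=> X a Xa; split=> [x Xx|b Xb].
    by rewrite phiN0 //; exact: (pre_meet_inf (pl_prelattice P) Xa).1.
  apply: (key b a [set (b, x) | x in X]).
  + by apply: finite_image; case: (op_domain Xa).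
  + move=> c cG; apply: (con_meet c Xa).2 => x Xx; apply: (cG (b, x)).
    by exists x.
  + by move=> _ [x Xx <-]; exact: Xb.
Qed.

End SemilatticeValues.

(** * The initial lattice and the elements that make its values cofinal *)

Section BaseLattice.
Context d (S : bLatticeType d) (hS : conditionally_co_brouwerian S).
Context (P : partialLattice) (phi : conc P -> S) (phiM : join0_morphism phi).
Context (p0 : P) (lo hi : bool).

Inductive base_rel (s : S) : P + S -> P + S -> Prop :=
| base_P x y : phiN phi x y <= s -> base_rel s (inl x) (inl y)
| base_zp r : lo || (r <= s) -> base_rel s (inr r) (inl p0)
| base_pz r : hi || (r <= s) -> base_rel s (inl p0) (inr r).

Inductive base_join : set (P + S) -> P + S -> Prop :=
| base_joinP X a : pjoin X a -> base_join (inl @` X) (inl a).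

Inductive base_meet : set (P + S) -> P + S -> Prop :=
| base_meetP X a : pmeet X a -> base_meet (inl @` X) (inl a).

Notation base_prov := (prov base_rel base_join base_meet).

Lemma base_conn x y : exists s, base_prov s (tgen x) (tgen y).
Proof.
have up u : exists s q, base_prov s (tgen u) (tgen (inl q)).
  case: u => [q|r]; first by exists \bot, q; exact: prov_refl.
  by exists r, p0; apply: (prov_gen (lexx _)); constructor; rewrite lexx orbT.
have dn u : exists s q, base_prov s (tgen (inl q)) (tgen u).
  case: u => [q|r]; first by exists \bot, q; exact: prov_refl.
  by exists r, p0; apply: (prov_gen (lexx _)); constructor; rewrite lexx orbT.
have [s [q H]] := up x; have [s' [q' H']] := dn y.
exists (s `|` s' `|` phiN phi q q').
apply: (@prov_trans _ _ _ _ _ _ _ _ (tgen (inl q))).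
  by apply: prov_mono H; rewrite -joinA leUl.
apply: (@prov_trans _ _ _ _ _ _ _ _ (tgen (inl q'))).
  by apply: (prov_gen (leUr _ _)); constructor.
by apply: prov_mono H'; rewrite joinAC leUr.
Qed.

Definition base : vlattice S := free_vlattice hS base_conn.
Definition base_emb (p : P) : base := tgen (inl p).
(* [base_z r] equals [p0] with value [r]; otherwise it is below [P] if [lo] and
   above [P] if [hi]. If both flags are set, it always equals [p0]. *)
Definition base_z (r : S) : base := tgen (inr r).

(** P with two added bounds, which are the places of a new generator whose equality with [p0] fails
    at [I]. *)
Inductive bounded := Fin of P | NegInf | PosInf.

Definition base_val (I : set S) (u : P + S) : bounded :=
  match u with
  | inl x => Fin x
  | inr r => if `[< I r >] || lo && hi then Fin p0
             else if lo then NegInf else PosInf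
  end.

Definition bounded_le (I : set S) (u v : bounded) : Prop :=
  match u, v with
  | NegInf, _ | _, PosInf => True
  | Fin x, Fin y => I (phiN phi x y)
  | _, _ => False
  end.

Lemma base_adapted I : prime_ideal I -> adapted base_rel base_join base_meet I
  (fun u v => bounded_le I (base_val I u) (base_val I v)).
Proof.
move=> Ip; have [_ [rr rt] rj rm] := phiN_prelattice phiM Ip.
have [_ Idn _ _] := Ip.
split.
- by move=> x; case: (base_val I x) => //= y; exact: rr.
- move=> x y z; case: (base_val I x) (base_val I y) (base_val I z) =>
    [a||] [b||] [c||] //=; exact: rt.
- move=> s _ _ Is [x y xys|r|r] /=; first exact: Idn Is.
  + case: asboolP => [_|nIr] /= => [|H]; first by move=> _; exact: rr.
    have -> : lo by case/orP: H => // rs; case: nIr; exact: Idn Is.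
    by case: hi => //=; exact: rr.
  + case: asboolP => [_|nIr] /= => [|H]; first by move=> _; exact: rr.
    have -> : hi by case/orP: H => // rs; case: nIr; exact: Idn Is.
    by case: lo => //=; exact: rr.
- move=> _ _ [X a Xa]; have [finX [x0 Xx0]] := op_domain Xa.
  have [ub lb] := rj X a Xa.
  split=> [_ [x Xx <-]|u Xu]; first exact: ub.
  have {Xu} := fun x Xx => Xu (inl x) (ex_intro2 _ _ x Xx erefl).
  rewrite [base_val I (inl _)]/=; case: (base_val I u) => [b Xb||] //=.
    exact: lb.
  (* A prescribed join is taken over a nonempty set, which [NegInf] cannot bound from above. *)
  by move=> /(_ _ Xx0).
- move=> _ _ [X a Xa]; have [finX [x0 Xx0]] := op_domain Xa.
  have [ub lb] := rm X a Xa.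
  split=> [_ [x Xx <-]|u Xu]; first exact: ub.
  have {Xu} := fun x Xx => Xu (inl x) (ex_intro2 _ _ x Xx erefl).
  rewrite [base_val I (inl _)]/=; case: (base_val I u) => [b Xb||] //=.
    exact: lb.
  by move=> /(_ _ Xx0).
Qed.

Lemma base_embN x y : vN (base_emb x) (base_emb y) = phiN phi x y.
Proof.
apply/le_anti/andP; split.
  by apply: (free_N_le hS base_conn); apply: (prov_gen (lexx _)); constructor.
apply: (free_N_conservative hS base_conn) => I Ip.
by eexists; [exact: base_adapted Ip|].
Qed.

Lemma base_z_lo r : lo -> vN (base_z r) (base_emb p0) = \bot.
Proof.
move=> L; apply: (free_N0 hS base_conn); apply: (prov_gen (lexx _)).
by constructor; rewrite L.
Qed.

Lemma base_z_hi r : hi -> vN (base_emb p0) (base_z r) = \bot.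
Proof.
move=> L; apply: (free_N0 hS base_conn); apply: (prov_gen (lexx _)).
by constructor; rewrite L.
Qed.

(** At a prime ideal omitting r, the new element sits at a bound, apart from [p0]. So the values of
    [vN] are cofinal in [S] even if those of [phi] are not. *)
Lemma base_z_ge r : ~~ (lo && hi) -> exists x y : base, r <= vN x y.
Proof.
move=> /negPf nlh; have [L|L] := boolP lo.
  exists (base_emb p0), (base_z r).
  apply: (free_N_conservative hS base_conn) => I Ip.
  eexists; first exact: base_adapted Ip.
  by rewrite /= nlh orbF; case: asboolP => //; rewrite L.
exists (base_z r), (base_emb p0).
apply: (free_N_conservative hS base_conn) => I Ip.
eexists; first exact: base_adapted Ip.
by rewrite /= nlh orbF; case: asboolP => //; rewrite (negPf L).
Qed.

(** Turns a join prescribed on a set into an iterated binary join, the form that embeddings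
    preserve. *)
Lemma base_join_list X a : pjoin X a -> exists x l,
  (forall y, List.In y (x :: l) -> X y) /\
  vN (base_emb a) (vbigJ (base_emb x) (map base_emb l)) = \bot.
Proof.
move=> Xa; have [/finite_set_list[[|x l] Xl] [x0 Xx0]] := op_domain Xa.
  by have /Xl := Xx0.
exists x, l; split=> [y /Xl //|].
apply: (free_N0 hS base_conn); apply: (prov_lub (base_joinP Xa)) => _ [y /Xl yl
  <-].
elim: l x {Xl} yl => [|z l IHl] x /= [->|yl] //; try exact: prov_refl.
  exact: prov_joinl.
by apply: prov_trans (prov_joinr _ _ _ _ _ _); exact: IHl.
Qed.

Lemma base_meet_list X a : pmeet X a -> exists x l,
  (forall y, List.In y (x :: l) -> X y) /\
  vN (vbigM (base_emb x) (map base_emb l)) (base_emb a) = \bot.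
Proof.
move=> Xa; have [/finite_set_list[[|x l] Xl] [x0 Xx0]] := op_domain Xa.
  by have /Xl := Xx0.
exists x, l; split=> [y /Xl //|].
apply: (free_N0 hS base_conn); apply: (prov_glb (base_meetP Xa)) => _ [y /Xl yl
  <-].
elim: l x {Xl} yl => [|z l IHl] x /= [->|yl] //; try exact: prov_refl.
  exact: prov_meetl.
by apply: prov_trans (prov_meetr _ _ _ _ _ _) _; exact: IHl.
Qed.

End BaseLattice.

(** * Saturation *)

Section Generation.
Context d (S : bLatticeType d).

Record vconvex (V : vlattice S) (D : set V) : Prop := VConvex {
  vconvexJ : forall x y, D x -> D y -> D (vJ x y);
  vconvexM : forall x y, D x -> D y -> D (vM x y);
  vconvexB : forall x y z,
    D x -> D z -> vN x y = \bot -> vN y z = \bot -> D y }.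

Definition vgenerates (V : vlattice S) (G : set V) : Prop :=
  forall D, vconvex D -> G `<=` D -> forall x, D x.

Lemma vconvex_eqv (V : vlattice S) (D : set V) x y :
  vconvex D -> veqv x y -> D x -> D y.
Proof. by move=> Dc [xy yx] Dx; apply: (vconvexB Dc Dx Dx). Qed.

(** A new element lies between its b and a, which come from [V], so convexity captures it; the rest
    is induction on terms. *)
Lemma step_generates hS (V : vlattice S) :
  @vgenerates (step hS V) (range (@step_emb _ _ hS V)).
Proof.
move=> D Dc GD; elim=> [[q|p]|t Dt u Du|t Dt u Du].
- by apply: GD; exists q.
- apply: (vconvexB Dc (x := step_emb hS (pb p)) (z := step_emb hS (pa p))).
  + by apply: GD; exists (pb p).
  + by apply: GD; exists (pa p).
  + apply: (free_N0 hS (@step_conn _ _ V)).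
    by apply: (prov_gen (lexx _)); constructor.
  + apply: (free_N0 hS (@step_conn _ _ V)).
    by apply: (prov_gen (lexx _)); constructor.
- exact: (vconvexJ Dc).
- exact: (vconvexM Dc).
Qed.

Lemma base_generates hS (P : partialLattice) (phi : conc P -> S) p0 lo hi :
  @vgenerates (base hS phi p0 lo hi)
    (range (base_emb hS phi p0 lo hi) `|` range (base_z hS phi p0 lo hi)).
Proof.
move=> D Dc GD; elim=> [[p|r]|t Dt u Du|t Dt u Du].
- by apply: GD; left; exists p.
- by apply: GD; right; exists r.
- exact: (vconvexJ Dc).
- exact: (vconvexM Dc).
Qed.

Lemma solution_eqv (V : vlattice S) (a b x y a' b' x' y' m m' : V) s t :
  veqv a a' -> veqv b b' -> veqv x x' -> veqv y y' -> veqv m m' ->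
  solution a b x y s t m -> solution a' b' x' y' s t m'.
Proof.
move=> aa bb xx yy mm [H1 H2 H3 H4 H5 H6 H7].
split.
- by rewrite -(vN_eqv bb mm).
- by rewrite -(vN_eqv mm aa).
- by rewrite -(vN_eqv aa mm).
- by rewrite -(vN_eqv mm bb).
- by rewrite -(vN_eqv aa mm) -(vN_eqv aa bb).
- by rewrite -(vN_eqv aa (vJ_eqv mm xx)).
- by rewrite -(vN_eqv (vM_eqv mm yy) bb).
Qed.

End Generation.

(** The induction shifts the family [Q] by one index, which avoids casts between levels; below n the
    path takes the arbitrary values of [i]. *)
Lemma chain_path (Q : nat -> Type) (e : forall n, Q n -> Q n.+1)
  (i : forall n, Q n) n (x : Q n) :
  exists f : forall n, Q n, f n = x /\ forall m, (n <= m)%N -> f m.+1 = e m (f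
    m).
Proof.
elim: n Q e i x => [|n IHn] Q e i x.
  by exists (nat_rect Q x e).
have [f [fx fe]] := IHn (fun m => Q m.+1) (fun m => @e m.+1) (fun m => i m.+1)
  x.
exists (nat_rect Q (i 0) (fun m _ => f m)); split=> // -[//|m] nm /=.
exact: fe.
Qed.

(** * The direct limit of a chain of embeddings *)

Section Limit.
Context d (S : bLatticeType d) (Q : nat -> vlattice S).
Context (e : forall n, Q n -> Q n.+1) (q0 : Q 0).
Context (eN : forall n (x y : Q n), vN (e x) (e y) = vN x y).
Context (eJ : forall n (x y : Q n), veqv (e (vJ x y)) (vJ (e x) (e y))).
Context (eM : forall n (x y : Q n), veqv (e (vM x y)) (vM (e x) (e y))).

Definition thread_from n (f : forall n, Q n) : Prop :=
  forall m, (n <= m)%N -> veqv (f m.+1) (e (f m)).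

(* Only the tails of threads matter, so the limit needs no transport along
   equalities of indices. *)
Record thread : Type := Thread {
  thread_fun :> forall n, Q n;
  threadP : exists n, thread_from n thread_fun }.

Implicit Types f g h : thread.

Lemma thread_fromS n m (f : forall n, Q n) : (n <= m)%N ->
  thread_from n f -> thread_from m f.
Proof. by move=> nm H k mk; apply: H; apply: leq_trans mk. Qed.

Lemma thread_fromJ n (f g : forall n, Q n) :
  thread_from n f -> thread_from n g -> thread_from n (fun n => vJ (f n) (g n)).
Proof.
move=> fn gn m nm; apply: veqv_trans (veqv_sym (eJ _ _)).
by apply: vJ_eqv; [exact: fn|exact: gn].
Qed.

Lemma thread_fromM n (f g : forall n, Q n) :
  thread_from n f -> thread_from n g -> thread_from n (fun n => vM (f n) (g n)).
Proof.
move=> fn gn m nm; apply: veqv_trans (veqv_sym (eM _ _)).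
by apply: vM_eqv; [exact: fn|exact: gn].
Qed.

Lemma threads_from f g : exists n, thread_from n f /\ thread_from n g.
Proof.
have [n fn] := threadP f; have [m gm] := threadP g.
by exists (maxn n m); split; [apply: thread_fromS fn|apply: thread_fromS gm];
  rewrite leq_max leqnn ?orbT.
Qed.

(** The values are eventually constant because [e] preserves [vN], so the default never serves as a
    fallback. *)
Definition lim_N f g : S :=
  xget \bot [set v | exists n, forall m, (n <= m)%N -> vN (f m) (g m) = v].

Lemma lim_NE n f g : thread_from n f -> thread_from n g ->
  lim_N f g = vN (f n) (g n).
Proof.
move=> fn gn.
have st k : vN (f (n + k)%N) (g (n + k)%N) = vN (f n) (g n).
  elim: k => [|k <-]; first by rewrite addn0.
  by rewrite addnS -[RHS]eN; apply: vN_eqv; [apply: fn|apply: gn];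
    exact: leq_addr.
have Hn : exists n0, forall m, (n0 <= m)%N -> vN (f m) (g m) = vN (f n) (g n).
  by exists n => m /subnKC <-; exact: st.
apply: (xget_unique \bot Hn) => v [n1 H1];
  rewrite -(H1 (n + n1)%N) ?leq_addl //.
Qed.

Definition lim_join f g : thread.
Proof.
exists (fun n => vJ (f n) (g n)).
by have [n [fn gn]] := threads_from f g; exists n; exact: thread_fromJ.
Defined.

Definition lim_meet f g : thread.
Proof.
exists (fun n => vM (f n) (g n)).
by have [n [fn gn]] := threads_from f g; exists n; exact: thread_fromM.
Defined.

Lemma threads_from3 f g h : exists n,
  [/\ thread_from n f, thread_from n g & thread_from n h].
Proof.
have [n [fn gn]] := threads_from f g; have [m hm] := threadP h.
by exists (maxn n m); split; [apply: thread_fromS fn|apply: thread_fromS gn|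
  apply: thread_fromS hm]; rewrite leq_max leqnn ?orbT.
Qed.

Definition lim : vlattice S.
Proof.
refine (@VLattice _ S thread lim_N lim_join lim_meet _ _ _ _ _ _ _ _).
- by move=> f; have [n fn] := threadP f; rewrite (lim_NE fn fn) vNxx.
- move=> f g h; have [n [fn gn hn]] := threads_from3 f g h.
  by rewrite (lim_NE fn hn) (lim_NE fn gn) (lim_NE gn hn) vN_trans.
- move=> f g; have [n [fn gn]] := threads_from f g.
  by rewrite (@lim_NE n) //= ?vNJl //; exact: thread_fromJ.
- move=> f g; have [n [fn gn]] := threads_from f g.
  by rewrite (@lim_NE n) //= ?vNJr //; exact: thread_fromJ.
- move=> f g h; have [n [fn gn hn]] := threads_from3 f g h.
  by rewrite !(@lim_NE n) //= ?vNJ //; exact: thread_fromJ.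
- move=> f g; have [n [fn gn]] := threads_from f g.
  by rewrite (@lim_NE n) //= ?vNMl //; exact: thread_fromM.
- move=> f g; have [n [fn gn]] := threads_from f g.
  by rewrite (@lim_NE n) //= ?vNMr //; exact: thread_fromM.
- move=> f g h; have [n [fn gn hn]] := threads_from3 f g h.
  by rewrite !(@lim_NE n) //= ?vNM //; exact: thread_fromM.
Defined.

Lemma lim_thread n (x : Q n) : {f : lim | thread_from n f /\ f n = x}.
Proof.
apply: cid.
(* The iterates of [q0] fill the levels below n. *)
have [f [fx fe]] := chain_path (Q := Q) e (nat_rect Q q0 e) x.
have fn : thread_from n f by move=> m nm; rewrite fe //; exact: veqv_refl.
by exists (Thread (ex_intro _ n fn)).
Qed.

Lemma lim_veqv n (f g : lim) : thread_from n f -> thread_from n g ->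
  veqv (f n) (g n) -> veqv f g.
Proof. by move=> fn gn [fg gf]; split; rewrite /= (@lim_NE n). Qed.

(** The elements of level n all of whose threads lie in [D] form a convex sublattice, to which
    generation by [G] applies. Threads are matched up to [veqv]. *)
Lemma lim_convex_from n (G : set (Q n)) (D : set lim) : vgenerates G ->
  vconvex D -> (forall f : lim, thread_from n f -> G (f n) -> D f) ->
  forall f : lim, thread_from n f -> D f.
Proof.
move=> gG Dc GD f fn.
suff H x : forall f : lim, thread_from n f -> veqv x (f n) -> D f.
  by apply: (H (f n)) => //; exact: veqv_refl.
apply: (gG [set x | forall f : lim, thread_from n f -> veqv x (f n) -> D f]).
  split=> [y z Dy Dz g gn yzg|y z Dy Dz g gn yzg|y z w Dy Dw yz zw g gn zg].
  - have [ty [tyn tyy]] := lim_thread y; have [tz [tzn tzz]] := lim_thread z.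
    apply: (@vconvex_eqv _ _ _ _ (vJ ty tz) g Dc).
      apply: (@lim_veqv n) => //; first exact: thread_fromJ.
      by rewrite /= tyy tzz.
    apply: (vconvexJ Dc); [apply: Dy|apply: Dz] => //;
      by rewrite ?tyy ?tzz; exact: veqv_refl.
  - have [ty [tyn tyy]] := lim_thread y; have [tz [tzn tzz]] := lim_thread z.
    apply: (@vconvex_eqv _ _ _ _ (vM ty tz) g Dc).
      apply: (@lim_veqv n) => //; first exact: thread_fromM.
      by rewrite /= tyy tzz.
    apply: (vconvexM Dc); [apply: Dy|apply: Dz] => //;
      by rewrite ?tyy ?tzz; exact: veqv_refl.
  - have [ty [tyn tyy]] := lim_thread y; have [tw [twn tww]] := lim_thread w.
    apply: (vconvexB Dc (x := ty) (z := tw)).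
    + by apply: Dy => //; rewrite tyy; exact: veqv_refl.
    + by apply: Dw => //; rewrite tww; exact: veqv_refl.
    + by rewrite /= (@lim_NE n) // tyy -(vN_eqv (veqv_refl y) zg).
    + by rewrite /= (@lim_NE n) // tww -(vN_eqv zg (veqv_refl w)).
move=> y Gy g gn yg; have [ty [tyn tyy]] := lim_thread y.
apply: (@vconvex_eqv _ _ _ _ ty g Dc).
  by apply: (@lim_veqv n) => //; rewrite tyy.
by apply: GD; rewrite ?tyy.
Qed.

Definition lim_emb (x : Q 0) : lim := sval (lim_thread x).

Lemma lim_emb_from x : thread_from 0 (lim_emb x).
Proof. by rewrite /lim_emb; case: (lim_thread x) => f []. Qed.

Lemma lim_embE x : lim_emb x 0 = x.
Proof. by rewrite /lim_emb; case: (lim_thread x) => f []. Qed.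

Lemma lim_embN x y : vN (lim_emb x) (lim_emb y) = vN x y.
Proof. by rewrite /= (lim_NE (@lim_emb_from x) (@lim_emb_from y)) !lim_embE.
  Qed.

Lemma lim_embJ x y : veqv (lim_emb (vJ x y)) (vJ (lim_emb x) (lim_emb y)).
Proof.
apply: (@lim_veqv 0); first exact: lim_emb_from.
  by apply: thread_fromJ; exact: lim_emb_from.
by rewrite /= !lim_embE; exact: veqv_refl.
Qed.

Lemma lim_embM x y : veqv (lim_emb (vM x y)) (vM (lim_emb x) (lim_emb y)).
Proof.
apply: (@lim_veqv 0); first exact: lim_emb_from.
  by apply: thread_fromM; exact: lim_emb_from.
by rewrite /= !lim_embE; exact: veqv_refl.
Qed.

(** Induction on the level where a thread starts: a thread from n+1 whose value there is e q is
    equivalent to a thread from n, and such values generate level n+1. *)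
Lemma lim_generates (G : set (Q 0)) : vgenerates G ->
  (forall n, vgenerates (range (@e n))) -> vgenerates (lim_emb @` G).
Proof.
move=> gG ge D Dc GD f; have [n] := threadP f.
elim: n f => [|n IHn] f.
  apply: (lim_convex_from gG Dc) => {}f f0 Gf.
  apply: (@vconvex_eqv _ _ _ _ (lim_emb (f 0)) f Dc).
    apply: (@lim_veqv 0) => //; first exact: lim_emb_from.
    by rewrite lim_embE; exact: veqv_refl.
  by apply: GD; exists (f 0).
apply: (lim_convex_from (ge n) Dc) => {}f fn [q _ eq].
have [t [tn tq]] := lim_thread q.
apply: (@vconvex_eqv _ _ _ _ t f Dc); last exact: IHn.
apply: (@lim_veqv n.+1) => //; first exact: thread_fromS tn.
by rewrite -eq -tq; exact: tn.
Qed.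

(** The data of a problem live at a common level, and the next level contains a solution. *)
Lemma lim_solve :
  (forall n (a b x y : Q n) s t, solvable a b x y s t ->
    exists m, solution (e a) (e b) (e x) (e y) s t m) ->
  forall (a b x y : lim) s t, solvable a b x y s t ->
    exists m, solution a b x y s t m.
Proof.
move=> solve a b x y s t.
have [n [na nb nx ny]] : exists n,
    [/\ thread_from n a, thread_from n b, thread_from n x & thread_from n y].
  have [n [an bn]] := threads_from a b; have [m [xm ym]] := threads_from x y.
  by exists (maxn n m); split; [apply: thread_fromS an|apply: thread_fromS bn|
    apply: thread_fromS xm|apply: thread_fromS ym]; rewrite leq_max leqnn ?orbT.
move=> H; have {H} : solvable (a n) (b n) (x n) (y n) s t.
  by case: H => /= *; split; rewrite -!(@lim_NE n).
move=> /solve[m]; have [h [hn <-]] := lim_thread m => H.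
exists h.
have [Sa Sb Sx Sy] : [/\ thread_from n.+1 a, thread_from n.+1 b,
    thread_from n.+1 x & thread_from n.+1 y].
  by split; [apply: thread_fromS na|apply: thread_fromS nb|
    apply: thread_fromS nx|apply: thread_fromS ny].
have {H} : solution (a n.+1) (b n.+1) (x n.+1) (y n.+1) s t (h n.+1).
  by apply: solution_eqv H; [exact/veqv_sym/na|exact/veqv_sym/nb|
    exact/veqv_sym/nx|exact/veqv_sym/ny|exact: veqv_refl].
case=> *; split; rewrite /= ?(@lim_NE n.+1) //=.
- exact: thread_fromJ.
- exact: thread_fromM.
Qed.

End Limit.

Section Saturation.
Context d (S : bLatticeType d) (hS : conditionally_co_brouwerian S).

Fixpoint step_chain (V : vlattice S) n : vlattice S :=
  if n is n'.+1 then step hS (step_chain V n') else V.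

Definition saturated (V : vlattice S) : Prop :=
  forall (a b x y : V) s t, solvable a b x y s t -> exists m, solution a b x y
    s t m.

Record vembedding (V W : vlattice S) (j : V -> W) : Prop := VEmbedding {
  vembN : forall x y, vN (j x) (j y) = vN x y;
  vembJ : forall x y, veqv (j (vJ x y)) (vJ (j x) (j y));
  vembM : forall x y, veqv (j (vM x y)) (vM (j x) (j y)) }.

Lemma saturation (V : vlattice S) (G : set V) (v0 : V) : vgenerates G ->
  exists (W : vlattice S) (j : V -> W),
    [/\ vembedding j, saturated W & vgenerates (j @` G)].
Proof.
move=> gG.
pose e n := @step_emb _ _ hS (step_chain V n).
have eN n := @step_embN _ _ hS (step_chain V n).
have eJ n := @step_embJ _ _ hS (step_chain V n).
have eM n := @step_embM _ _ hS (step_chain V n).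
exists (lim (Q := step_chain V) (e := e) eN eJ eM).
exists (lim_emb (Q := step_chain V) (e := e) v0 eN eJ eM); split.
- split=> x y; [exact: lim_embN|exact: lim_embJ|exact: lim_embM].
- apply: lim_solve; first exact: v0.
  by move=> n a b x y s t; exact: step_solve.
- by apply: lim_generates gG _ => n; exact: step_generates.
Qed.

Lemma vembedding_bigJ (V W : vlattice S) (j : V -> W) x l : vembedding j ->
  veqv (j (vbigJ x l)) (vbigJ (j x) (map j l)).
Proof.
move=> je; elim: l x => [|y l IHl] x /=; first exact: veqv_refl.
apply: veqv_trans (vembJ je _ _) _; apply: vJ_eqv => //; exact: veqv_refl.
Qed.

Lemma vembedding_bigM (V W : vlattice S) (j : V -> W) x l : vembedding j ->
  veqv (j (vbigM x l)) (vbigM (j x) (map j l)).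
Proof.
move=> je; elim: l x => [|y l IHl] x /=; first exact: veqv_refl.
apply: veqv_trans (vembM je _ _) _; apply: vM_eqv => //; exact: veqv_refl.
Qed.

End Saturation.

(** * Congruences of saturated lattices *)

Section Quotient.
Context d (S : bLatticeType d) (V : vlattice S).

Record vquot : Type := VQuot {
  vclass : set V;
  vclassP : exists x, vclass = [set y | veqv x y] }.

Definition vpi (x : V) : vquot := VQuot (ex_intro _ x erefl).
Definition vrepr (c : vquot) : V := sval (cid (vclassP c)).

Lemma vpi_eq x y : veqv x y -> vpi x = vpi y.
Proof.
move=> xy; rewrite /vpi; have e : [set z | veqv x z] = [set z | veqv y z].
  apply/seteqP; split=> z /= H; last exact: veqv_trans H.
  exact: veqv_trans (veqv_sym xy) H.
case: _ / e (ex_intro _ y _ : exists y, _ = _) => H.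
by congr VQuot; exact: Prop_irrelevance.
Qed.

Lemma vreprK c : vpi (vrepr c) = c.
Proof.
rewrite /vrepr; case: cid => x /=; case: c => A H /= e.
by case: _ / (esym e) H => H; congr VQuot; exact: Prop_irrelevance.
Qed.

Lemma vpiK x : veqv (vrepr (vpi x)) x.
Proof.
rewrite /vrepr; case: cid => y /= /seteqP[+ _]; apply; exact: veqv_refl.
Qed.

Definition qN (a b : vquot) : S := vN (vrepr a) (vrepr b).

Lemma qN_pi x y : qN (vpi x) (vpi y) = vN x y.
Proof. by apply: vN_eqv; exact: vpiK. Qed.

Definition vquot_le (a b : vquot) : bool := qN a b == \bot.
Definition vquot_join (a b : vquot) := vpi (vJ (vrepr a) (vrepr b)).
Definition vquot_meet (a b : vquot) := vpi (vM (vrepr a) (vrepr b)).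

Fact vquot_le_refl : reflexive vquot_le.
Proof. by move=> a; rewrite /vquot_le /qN vNxx. Qed.

Fact vquot_le_anti : antisymmetric vquot_le.
Proof.
move=> a b /andP[/eqP ab /eqP ba].
by rewrite -[a]vreprK -[b]vreprK; exact: vpi_eq.
Qed.

Fact vquot_le_trans : transitive vquot_le.
Proof. by move=> b a c /eqP ab /eqP bc; apply/eqP; exact: vN_trans0 ab bc. Qed.

Fact vquot_display : Order.disp_t. Proof. exact: (Order.Disp tt tt). Qed.

HB.instance Definition _ := gen_eqMixin vquot.
HB.instance Definition _ := gen_choiceMixin vquot.
HB.instance Definition _ := @Order.Le_isPOrder.Build vquot_display vquot
  vquot_le vquot_le_refl vquot_le_anti vquot_le_trans.

Lemma vquot_leE (a b : vquot) : (a <= b) = (qN a b == \bot).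
Proof. by []. Qed.

Lemma qNJ a b c : qN (vquot_join a b) c = qN a c `|` qN b c.
Proof. by rewrite -[c in LHS]vreprK qN_pi vNJE. Qed.

Lemma qNM a b c : qN c (vquot_meet a b) = qN c a `|` qN c b.
Proof. by rewrite -[c in LHS]vreprK qN_pi vNME. Qed.

Fact vquot_leUx (a b c : vquot) : (vquot_join a b <= c) = (a <= c) && (b <= c).
Proof. by rewrite !vquot_leE qNJ -!lex0 leUx. Qed.

Fact vquot_lexI (c a b : vquot) : (c <= vquot_meet a b) = (c <= a) && (c <= b).
Proof. by rewrite !vquot_leE qNM -!lex0 leUx. Qed.

HB.instance Definition _ := @Order.POrder_isJoinSemilattice.Build vquot_display
  vquot vquot_join vquot_leUx.
HB.instance Definition _ := @Order.POrder_isMeetSemilattice.Build vquot_display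
  vquot vquot_meet vquot_lexI.

End Quotient.

Record saturated_distance d (S : bLatticeType d) dL (L : latticeType dL)
    (N : L -> L -> S) : Prop := SaturatedDistance {
  sd0 : forall x y, (x <= y) = (N x y == \bot);
  sd_trans : forall x y z, N x z <= N x y `|` N y z;
  sdJ : forall x y z, N (x `|` y) z = N x z `|` N y z;
  sdM : forall x y z, N z (x `&` y) = N z x `|` N z y;
  sd_solve : forall a b x y s t, b <= a -> x <= a -> b <= y ->
    N a b <= s `|` t -> N a x <= t -> s `&` N a b <= N x b ->
    N y b <= s -> t `&` N a b <= N a y ->
    exists m, [/\ b <= m <= a, N a m <= s, N m b <= t,
      s `&` N a b <= N a m & a <= m `|` x /\ m `&` y <= b] }.

Lemma vquot_saturated d (S : bLatticeType d) (V : vlattice S) :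
  saturated V -> saturated_distance (@qN _ _ V).
Proof.
move=> sat; split.
- by [].
- by move=> x y z; exact: vN_trans.
- by move=> x y z; rewrite -qNJ.
- by move=> x y z; rewrite -qNM.
- move=> a b x y s t /eqP ba /eqP xa /eqP by_ abst axt sxb yst tay.
  have [m [H1 H2 H3 H4 H5 H6 H7]] := sat _ _ _ _ _ _ (Solvable ba xa by_ abst
    axt sxb yst tay).
  exists (vpi m); have e := veqv_sym (vpiK m).
  have er (z : vquot V) := veqv_refl (vrepr z).
  split.
  + by rewrite !vquot_leE /qN -(vN_eqv (er b) e) -(vN_eqv e (er a)) H1 H2 eqxx.
  + by rewrite /qN -(vN_eqv (er a) e).
  + by rewrite /qN -(vN_eqv e (er b)).
  + by rewrite /qN -(vN_eqv (er a) e).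
  + split; apply/eqP.
      rewrite -[a in LHS]vreprK qN_pi -[RHS]H6; apply: vN_eqv (er a) _.
      exact: vJ_eqv (veqv_sym e) (er x).
    rewrite -[b in LHS]vreprK qN_pi -[RHS]H7; apply: vN_eqv _ (er b).
    exact: vM_eqv (veqv_sym e) (er y).
Qed.

(** * The isomorphism from Con_c L onto S *)

Section SaturatedLattice.
Context d (S : bLatticeType d) dL (L : latticeType dL) (L0 : inhabited L).
Context (N : L -> L -> S) (sat : saturated_distance N).
Local Notation PL := (partial_of_lattice L0).
Implicit Types (x y z a b m : L).

Lemma sd_eq0 x y : x <= y -> N x y = \bot.
Proof. by rewrite (sd0 sat) => /eqP. Qed.

Lemma sd_mono x x' y y' : x' <= x -> y <= y' -> N x' y' <= N x y.
Proof.
move=> /sd_eq0 xx' /sd_eq0 yy'; apply: le_trans (sd_trans sat _ x _) _.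
by rewrite xx' join0x; apply: le_trans (sd_trans sat _ y _) _;
  rewrite yy' joinx0.
Qed.

Lemma sd_meetl x y : N x (x `&` y) = N x y.
Proof. by rewrite (sdM sat) sd_eq0 // join0x. Qed.

Lemma sd_joinr x y : N (x `|` y) y = N x y.
Proof. by rewrite (sdJ sat) [X in _ `|` X]sd_eq0 // joinx0. Qed.

Lemma saturated_complement o x i : o <= x <= i ->
  exists y, [/\ o <= y <= i, x `&` y = o & x `|` y = i].
Proof.
move=> /andP[ox xi].
have oi := le_trans ox xi.
(* The given x plays both x and y; [N x o] and [N i x] are the least s and t with N y b <= s and N a
   x <= t. *)
have [|||||m [/andP[om mi] _ _ _ [ji mo]]] :=
    @sd_solve _ _ _ _ _ sat i o x x (N x o) (N i x) oi xi ox.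
- by rewrite joinC; exact: sd_trans.
- exact: lexx.
- exact: leIl.
- exact: lexx.
- exact: leIl.
exists m; split; first exact/andP.
  by apply/le_anti; rewrite lexI ox om meetC mo.
by apply/le_anti; rewrite leUx xi mi joinC ji.
Qed.

Lemma saturated_relatively_complemented : relatively_complemented L.
Proof. by move=> o i x /saturated_complement[y [_ xy xi]]; exists y. Qed.

Lemma saturated_interpolation a b s t : b <= a -> N a b <= s `|` t ->
  exists m, [/\ b <= m <= a, N a m <= s, N m b <= t & s `&` N a b <= N a m].
Proof.
move=> ba abst.
(* With x = a and y = b, the join and meet conditions hold for every m in [b, a], so only the costs
   matter. *)
have [||||m [bma am mb amge _]] := @sd_solve _ _ _ _ _ sat a b a b s t ba (lexx
  _) (lexx _) abst.
- by rewrite sd_eq0 ?le0x.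
- exact: leIr.
- by rewrite sd_eq0 ?le0x.
- exact: leIr.
- by exists m.
Qed.

Section Congruence.
Context (theta : con PL).

Lemma con_le_lattice x y : x <= y -> theta x y.
Proof. by move=> xy; exact: (congr_ple (con_congr theta) (x := x : PL)). Qed.

Lemma con_lattice_join x y z : theta x z -> theta y z -> theta (x `|` y) z.
Proof.
move=> xz yz.
have H : @pjoin PL [set x; y] (x `|` y).
  split; [exact: finite_set2|by exists x; left|split].
    by move=> _ [->|->]; rewrite ?leUl ?leUr.
  by move=> u uu; rewrite leUx !uu //; [right|left].
by apply: (con_join theta H).2 => _ [->|->].
Qed.

Lemma con_lattice_meet x y z : theta z x -> theta z y -> theta z (x `&` y).
Proof.
move=> xz yz.
have H : @pmeet PL [set x; y] (x `&` y).
  split; [exact: finite_set2|by exists x; left|split].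
    by move=> _ [->|->]; rewrite ?leIl ?leIr.
  by move=> u uu; rewrite lexI !uu //; [right|left].
by apply: (con_meet theta H).2 => _ [->|->].
Qed.

(* A common complement [z] of [x] and [y] in the interval from [o] to their join
   makes the two intervals projective. *)
Lemma con_step0 o x y : o <= x -> o <= y -> x `&` y <= o ->
  N y o <= N x o -> theta x o -> theta y o.
Proof.
move=> ox oy xyo yo xo; pose i := x `|` y.
have xi : x <= i by exact: leUl.
have yi : y <= i by exact: leUr.
have oi := le_trans ox xi.
have io : N i o = N x o by rewrite (sdJ sat); exact: join_l.
have [|||||z [/andP[oz zi] _ _ _ [izx zyo]]] :=
    @sd_solve _ _ _ _ _ sat i o x y (N i o) (N i o) oi xi oy.
- by rewrite joinxx.
- exact: sd_mono.
- by rewrite -io leIl.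
- exact: sd_mono.
(* Since x ^ y <= o, the value N x o is at most N x (x ^ y) = N x y. *)
- rewrite meetxx io.
  apply: le_trans (_ : N x y <= _); last exact: sd_mono.
  by rewrite -[leRHS]sd_meetl; exact: sd_mono.
have yz : theta y z.
  apply: con_trans (con_le_lattice (le_trans yi izx)) _.
  apply: con_lattice_join; first exact: con_refl.
  by apply: con_trans xo (con_le_lattice oz).
apply: con_trans (con_le_lattice zyo).
apply: con_lattice_meet => //; exact: con_refl.
Qed.

(** Splits y into x ^ y, which collapses to o along with x, and a complement x' of it in [o, y],
    which meets x in o and so falls under [con_step0]. *)
Lemma con_step1 o x y : o <= x -> o <= y ->
  N y o <= N x o -> theta x o -> theta y o.
Proof.
move=> ox oy yo xo.
have oxy : o <= x `&` y <= y by rewrite lexI ox oy leIr.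
have [x' [/andP[ox' x'y] xx' jx']] := saturated_complement oxy.
have x'o : theta x' o.
  apply: con_step0 ox ox' _ _ xo; last exact: le_trans (sd_mono x'y (lexx _))
    yo.
  by rewrite -[leRHS]xx' !lexI leIl leIr (le_trans (leIr _ _) x'y).
rewrite -{1}jx'; apply: con_lattice_join => //.
by apply: con_trans xo; apply: con_le_lattice; exact: leIl.
Qed.

(** Relative complements y of b in [o, a] and x of e in [o, c] transpose both intervals down to the
    common bottom o = b ^ e, where [con_step1] compares them. *)
Lemma con_step2 a b (c e : L) : b <= a -> e <= c ->
  N a b <= N c e -> theta c e -> theta a b.
Proof.
move=> ba ec abce ce; pose o := b `&` e.
have [|x [/andP[ox xc] ex jx]] := @saturated_complement o e c.
  by rewrite leIr.
have [|y [/andP[oy ya] by_ jy]] := @saturated_complement o b a.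
  by rewrite leIl.
rewrite -jy; apply: con_lattice_join; first exact: con_refl.
apply: (@con_trans _ _ _ (o : PL)); last by apply: con_le_lattice; exact: leIl.
apply: con_step1 ox oy _ _.
  have -> : N y o = N y b by rewrite -by_ meetC sd_meetl.
  apply: le_trans (sd_mono ya (lexx b)) (le_trans abce _).
  by rewrite -[X in N X _ <= _]jx joinC sd_joinr; apply: sd_mono => //;
    exact: leIr.
rewrite -ex; apply: con_lattice_meet; last exact: con_refl.
by apply: con_trans (con_le_lattice xc) ce.
Qed.

(** An interpolant m splits [b, a] into a part charged to the first pair, collapsed by [con_step2],
    and a part charged to the remaining list. *)
Lemma con_of_distance (l : seq (L * L)) a b :
  (forall p, List.In p l -> theta p.1 p.2) ->
  N a b <= foldr (fun p s => N p.1 p.2 `|` s) \bot l -> theta a b.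
Proof.
move=> lt; wlog ba : a b / b <= a => [wl ab|].
  apply: (@con_trans _ _ _ (a `&` b : PL)); last by apply: con_le_lattice;
    exact: leIr.
  by apply: wl; rewrite ?leIl // sd_meetl.
elim: l a b ba lt => [|[c e] l IHl] a b ba lt /=.
  by rewrite lex0 -(sd0 sat); exact: con_le_lattice.
move=> /(saturated_interpolation ba)[m [/andP[bm ma] am mb _]].
apply: (@con_trans _ _ _ (m : PL)); last by apply: IHl => // p pl; apply: lt;
  right.
apply: (@con_step2 a m c (c `&` e)) => //; rewrite ?leIl // ?sd_meetl //.
apply: con_lattice_meet; first exact: con_refl.
by apply: (lt (c, e)); left.
Qed.

End Congruence.

Lemma distance_kernel_congr s : @is_congruence PL (fun x y => N x y <= s).
Proof.
split=> [x y /sd_eq0->|]; first exact: le0x.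
split=> //.
- split=> [x|x y z xy yz]; first by rewrite sd_eq0 ?le0x.
  by apply: le_trans (sd_trans sat _ y _) _; rewrite leUx xy yz.
- move=> X a [finX [x0 Xx0] [ub lub]]; split=> [x /ub/sd_eq0->|b Xb].
    exact: le0x.
  have [l Xl] := finite_set_list finX.
  have [u lu us] : exists2 u, (forall x, List.In x l -> x <= u) & N u b <= s.
    have : forall x, List.In x l -> N x b <= s by move=> x /Xl/Xb.
    elim: l {Xl} => [|x l IHl] H; first by exists x0 => //; exact: Xb.
    have [|u lu us] := IHl; first by move=> y yl; apply: H; right.
    exists (x `|` u); last by rewrite (sdJ sat) leUx us H //; left.
    by move=> y [<-|/lu yu]; [exact: leUl|exact: le_trans yu (leUr _ _)].
  apply: le_trans us; apply: sd_mono => //; apply: lub => x /Xl; exact: lu.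
- move=> X a [finX [x0 Xx0] [lb glb]]; split=> [x /lb/sd_eq0->|b Xb].
    exact: le0x.
  have [l Xl] := finite_set_list finX.
  have [u lu us] : exists2 u, (forall x, List.In x l -> u <= x) & N b u <= s.
    have : forall x, List.In x l -> N b x <= s by move=> x /Xl/Xb.
    elim: l {Xl} => [|x l IHl] H; first by exists x0 => //; exact: Xb.
    have [|u lu us] := IHl; first by move=> y yl; apply: H; right.
    exists (x `&` u); last by rewrite (sdM sat) leUx us H //; left.
    by move=> y [<-|/lu yu]; [exact: leIl|exact: le_trans (leIr _ _) yu].
  apply: le_trans us; apply: sd_mono => //; apply: glb => x /Xl; exact: lu.
Qed.

Definition distance_kernel s : con PL := Con (distance_kernel_congr s).

Lemma conc_distance_list (c : conc PL) : exists2 l : seq (L * L),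
  (forall p, List.In p l -> c p.1 p.2) &
  forall s, foldr (fun p s => N p.1 p.2 `|` s) \bot l <= s <->
    conc_val c <= distance_kernel s.
Proof.
have [G finG cG] := compact_con_gen (asboolP _ (conc_valP c)).
have [l Gl] := finite_set_list finG.
have lc p : List.In p l -> c p.1 p.2 by rewrite cG => /Gl; exact: sub_con_gen.
exists l => // s; split=> [H|/con_leP cs].
  rewrite cG; apply: con_gen_min => p /Gl {Gl lc cG}.
  elim: l H => //= q l IHl; rewrite leUx => /andP[qs ls] [<- //|]; exact: IHl.
elim: l {Gl} lc => [|p l IHl] lc /=; first exact: le0x.
rewrite leUx IHl ?andbT => [|q ql]; last by apply: lc; right.
by apply: (cs p.1 p.2); apply: lc; left.
Qed.

Lemma conc_distance_ex (c : conc PL) : exists v : S,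
  forall s, v <= s <-> conc_val c <= distance_kernel s.
Proof. by have [l _ H] := conc_distance_list c; eexists; exact: H. Qed.

(** Fixed by its universal property, hence independent of the generators chosen for c. This is the
    psi of the lift. *)
Definition conc_distance (c : conc PL) : S := sval (cid (conc_distance_ex c)).

Lemma conc_distanceP (c : conc PL) s : conc_distance c <= s <-> conc_val c <=
  distance_kernel s.
Proof. exact: (svalP (cid (conc_distance_ex c))). Qed.

(** Reflecting the order is the substantial half: [con_of_distance] turns a bound on distances into
    membership in c'. *)
Lemma conc_distance_le (c c' : conc PL) : (conc_distance c <= conc_distance c')
  = (c <= c').
Proof.
apply/idP/idP => [cc'|cc']; last first.
  by apply/conc_distanceP; apply: (@le_trans _ _ (conc_val c')) => //;
    apply/conc_distanceP.
have [l lc' H] := conc_distance_list c'.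
apply/con_leP => x y cxy; apply: (con_of_distance lc').
have /con_leP : conc_val c <= distance_kernel (foldr (fun p s => N p.1 p.2 `|`
  s) \bot l).
  apply/conc_distanceP/(le_trans cc')/conc_distanceP/H; exact: lexx.
exact.
Qed.

Lemma conc_distance_morphism : join0_morphism conc_distance.
Proof.
split.
  apply/eqP; rewrite -lex0; apply/conc_distanceP; apply: con_gen_min => p [].
move=> c c'; apply/le_anti; rewrite leUx !conc_distance_le leUl leUr !andbT.
apply/conc_distanceP; apply: con_gen_min => -[x y] [].
  have /con_leP : conc_val c <= distance_kernel (conc_distance c `|`
    conc_distance c').
    by apply/conc_distanceP; exact: leUl.
  exact.
have /con_leP : conc_val c' <= distance_kernel (conc_distance c `|`
  conc_distance c').
  by apply/conc_distanceP; exact: leUr.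
exact.
Qed.

(** Finitely many values are dominated by the one at the join of the left entries and the meet of
    the right ones. This passes cofinality from [phi] to [N]. *)
Lemma conc_distance_bounded (c : conc PL) : exists x y, conc_distance c <= N x
  y.
Proof.
have [l _ H] := conc_distance_list c.
suff [x [y lxy]] : exists x y, foldr (fun p s => N p.1 p.2 `|` s) \bot l <= N x
  y.
  by exists x, y; apply/conc_distanceP/H.
elim: l {H} => [|[a b] l [x [y lxy]]] /=.
  by case: L0 => x; exists x, x; exact: le0x.
exists (a `|` x), (b `&` y); rewrite leUx sd_mono ?leUl ?leIl //.
by apply: le_trans lxy _; rewrite sd_mono ?leUr ?leIr.
Qed.

Lemma conc_distance_iso : (forall s, exists x y, s <= N x y) ->
  join0_isomorphism conc_distance.
Proof.
move=> cof; split; first exact: conc_distance_morphism.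
have inj : injective conc_distance.
  by move=> c c' cc'; apply/le_anti; rewrite -!conc_distance_le cc' lexx.
have surj s : exists c, conc_distance c = s.
  have [x [y sxy]] := cof s.
  (* Between x and x ^ y there is an m with N x m exactly s, so s is the distance of the principal
     congruence of (x, m). *)
  have [||m [_ am _ sam]] := @saturated_interpolation x (x `&` y) s (N x y).
  - exact: leIl.
  - by rewrite sd_meetl leUr.
  have xm : N x m = s.
    by apply/le_anti; rewrite am -{1}(meet_l sxy) -[X in _ `&` X]sd_meetl.
  exists (@conc_pair PL x m); apply/le_anti; apply/andP; split;
    last rewrite -xm.
    by apply/conc_distanceP; apply: conc_pair_le; rewrite /= xm.
  have /con_leP : conc_val (@conc_pair PL x m)
      <= distance_kernel (conc_distance (@conc_pair PL x m)).
    exact/conc_distanceP.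
  by apply; exact: conc_pairP.
exists (fun s => sval (cid (surj s))) => [c|s];
  last exact: svalP (cid (surj s)).
by apply: inj; exact: svalP (cid (surj _)).
Qed.

(** Both sides have the same upper bounds in [S], since each is determined by the values of the
    pairs in c. *)
Lemma conc_distance_map (P : partialLattice) (f : plHom P PL) (phi : conc P ->
  S) :
  join0_morphism phi -> (forall x y : P, N (f x) (f y) = phiN phi x y) ->
  phi = conc_distance \o conc_map f.
Proof.
move=> phiM fN; apply/funext => c.
have key s : conc_distance (conc_map f c) <= s <-> phi c <= s.
  rewrite (phi_le phiM); split=> [/conc_distanceP/con_leP H x y cxy|H].
    rewrite -fN; apply: H; apply: (@sub_con_gen _ _ (f x, f y)).
    by exists (x, y).
  apply/conc_distanceP; apply: con_gen_min => _ [[x y] cxy <-].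
  by rewrite /con_graph /= fN; exact: H.
by apply/le_anti; apply/andP; split; [apply/key|apply/key].
Qed.

End SaturatedLattice.

(** * The lift *)

Section Lift.
Context (P : partialLattice) d (S : bLatticeType d) (phi : conc P -> S).
Context (hS : conditionally_co_brouwerian S) (phiM : join0_morphism phi).

Lemma vbigJ_lub (V : vlattice S) (x : V) l y :
  (forall z, List.In z (x :: l) -> vN z y = \bot) -> vN (vbigJ x l) y = \bot.
Proof.
elim: l x => [|z l IHl] x H /=; first by apply: H; left.
rewrite vNJE H ?join0x; last by left.
by apply: IHl => w wl; apply: H; right.
Qed.

Lemma vbigM_glb (V : vlattice S) (x : V) l y :
  (forall z, List.In z (x :: l) -> vN y z = \bot) -> vN y (vbigM x l) = \bot.
Proof.
elim: l x => [|z l IHl] x H /=; first by apply: H; left.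
rewrite vNME H ?join0x; last by left.
by apply: IHl => w wl; apply: H; right.
Qed.

(** One construction covers all cases: the flags place the new elements below P, above P or at [p0],
    and [D] is asked for just the closure that reaches them. *)
Lemma lift_exists (lo hi : bool) : (lo && hi -> cofinal_in (range phi)) ->
  lo || hi ->
  exists (dL : Order.disp_t) (L : latticeType dL) (L0 : inhabited L)
    (f : plHom P (partial_of_lattice L0))
    (psi : conc (partial_of_lattice L0) -> S),
  [/\ relatively_complemented L, join0_isomorphism psi,
      phi = psi \o conc_map f &
      forall D : set L, convex_sublattice D -> range (f : P -> L) `<=` D ->
        (lo && ~~ hi -> forall x y, x <= y -> D y -> D x) ->
        (hi && ~~ lo -> forall x y, x <= y -> D x -> D y) ->
        forall x, D x].
Proof.
move=> cof lohi.
have [p0] := pre_inhabited (pl_prelattice P).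
pose b := base_emb hS phi p0 lo hi; pose z := base_z hS phi p0 lo hi.
have [V [j [je Vsat Vgen]]] := saturation hS (b p0) (@base_generates _ _ hS P
  phi p0 lo hi).
have sat := vquot_saturated Vsat.
pose f p := vpi (j (b p)).
have L0 : inhabited (vquot V) := inhabits (f p0).
have fN p q : qN (f p) (f q) = phiN phi p q.
  by rewrite qN_pi (vembN je) base_embN.
have f_mono p q : ple p q -> lattice_le (f p) (f q).
  by move=> pq; rewrite /lattice_le vquot_leE fN phiN0.
have f_join X a : pjoin X a -> lattice_join_graph (f @` X) (f a).
  move=> Xa; have [finX [x0 Xx0]] := op_domain Xa.
  split; [exact: finite_image|by exists (f x0), x0|split].
    by move=> _ [x Xx <-]; apply/f_mono/(pre_join_sup (pl_prelattice P) Xa).1.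
  move=> u ub; have [x [l [lX al]]] := base_join_list hS phi p0 lo hi Xa.
  rewrite vquot_leE -[u]vreprK qN_pi; apply/eqP.
  apply: (@vN_trans0 _ _ _ _ (vbigJ (j (b x)) (map j (map b l)))).
    rewrite -(vN_eqv (veqv_refl _) (vembedding_bigJ (b x) (map b l) je)).
    by rewrite (vembN je).
  apply: vbigJ_lub => w H; have [y yl <-] : exists2 y, List.In y (x :: l) & j
    (b y) = w.
    case: H => [<-|]; first by exists x => //; left.
    by rewrite -map_comp => /in_map_iff[y [<- yl]]; exists y => //; right.
  have := ub (f y) (ex_intro2 _ _ y (lX y yl) erefl).
  by rewrite vquot_leE -{1}[u]vreprK qN_pi => /eqP.
have f_meet X a : pmeet X a -> lattice_meet_graph (f @` X) (f a).
  move=> Xa; have [finX [x0 Xx0]] := op_domain Xa.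
  split; [exact: finite_image|by exists (f x0), x0|split].
    by move=> _ [x Xx <-]; apply/f_mono/(pre_meet_inf (pl_prelattice P) Xa).1.
  move=> u ub; have [x [l [lX al]]] := base_meet_list hS phi p0 lo hi Xa.
  rewrite vquot_leE -[u]vreprK qN_pi; apply/eqP.
  apply: (@vN_trans0 _ _ _ _ (vbigM (j (b x)) (map j (map b l)))); last first.
    rewrite -(vN_eqv (vembedding_bigM (b x) (map b l) je) (veqv_refl _)).
    by rewrite (vembN je).
  apply: vbigM_glb => w H; have [y yl <-] : exists2 y, List.In y (x :: l) & j
    (b y) = w.
    case: H => [<-|]; first by exists x => //; left.
    by rewrite -map_comp => /in_map_iff[y [<- yl]]; exists y => //; right.
  have := ub (f y) (ex_intro2 _ _ y (lX y yl) erefl).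
  by rewrite vquot_leE -{1}[u]vreprK qN_pi => /eqP.
pose F : plHom P (partial_of_lattice L0) :=
  @PLHom P (partial_of_lattice L0) f f_mono f_join f_meet.
exists vquot_display, (vquot V), L0, F, (@conc_distance _ _ _ _ L0 _ sat).
have phiE : phi = @conc_distance _ _ _ _ L0 _ sat \o conc_map F by exact:
  conc_distance_map.
split=> //; first exact: saturated_relatively_complemented sat.
- apply: conc_distance_iso => s.
  (* With both flags set, cofinality comes from [phi]; otherwise the elements [base_z] supply it. *)
  have [lh|nlh] := boolP (lo && hi).
    have [_ [c _ <-] sc] := cof lh s.
    have [x [y cxy]] := conc_distance_bounded sat (conc_map F c).
    by exists x, y; apply: le_trans sc _; rewrite phiE.
  have [x [y sxy]] := base_z_ge hS phiM p0 s nlh.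
  by exists (vpi (j x)), (vpi (j y)); rewrite qN_pi (vembN je).
move=> D [DJ DM Dc] fD Dlo Dhi c; rewrite -[c]vreprK.
have vpi_le x y : vN x y = \bot -> vpi x <= vpi y.
  by move=> xy; rewrite vquot_leE qN_pi xy.
apply: (Vgen [set x | D (vpi x)]) => {c}.
  split=> [x y Dx Dy|x y Dx Dy|x y w Dx Dw xy yw] /=.
  - suff -> : vpi (vJ x y) = vpi x `|` vpi y by exact: DJ.
    by apply/vpi_eq/vJ_eqv; exact: veqv_sym (vpiK _).
  - suff -> : vpi (vM x y) = vpi x `&` vpi y by exact: DM.
    by apply/vpi_eq/vM_eqv; exact: veqv_sym (vpiK _).
  - by apply: Dc Dx Dw _; rewrite !vpi_le.
have fp p : D (f p) by apply: fD; exists p.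
have zlo r : lo -> vpi (j (z r)) <= f p0.
  by move=> L; apply: vpi_le; rewrite (vembN je) base_z_lo.
have zhi r : hi -> f p0 <= vpi (j (z r)).
  by move=> L; apply: vpi_le; rewrite (vembN je) base_z_hi.
move=> _ [_ [[p _ <-]|[r _ <-]] <-]; first exact: fp.
have [L|L] := boolP lo; have [H|H] := boolP hi.
- by apply: Dc (fp p0) (fp p0) _; rewrite zlo // zhi.
- by apply: Dlo (zlo r L) (fp p0); rewrite L H.
- by apply: Dhi (zhi r H) (fp p0); rewrite L H.
- by move: lohi; rewrite (negPf L) (negPf H).
Qed.

(** If the range of [phi] is cofinal, both flags are set and generation as a convex sublattice
    implies generation as [K]. Otherwise the clause on cofinal ranges is vacuous, and [lo] selects
    the side of the new elements. *)
Lemma good_lift_of (K : forall d (L : latticeType d), set L -> Prop) (lo :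
  bool) :
  (forall dL (L : latticeType dL) (D : set L), K dL L D -> convex_sublattice D)
    ->
  (forall dL (L : latticeType dL) (D : set L), K dL L D -> forall x y, x <= y ->
    if lo then D y -> D x else D x -> D y) ->
  good_lift K phi.
Proof.
move=> Kc Kd; have [cof|ncof] := pselect (cofinal_in (range phi)).
  have [//|//|dL [L [L0 [f [psi [rc iso phiE gen]]]]]] := @lift_exists true
    true.
  exists dL, L, L0, f, psi; split=> // [|_]; apply/seteqP;
    split=> // x _ D [KD fD].
    by apply: gen => //; exact: Kc KD.
  exact: gen.
have [||dL [L [L0 [f [psi [rc iso phiE gen]]]]]] := @lift_exists lo (~~ lo).
- by rewrite andbN.
- by rewrite orbN.
exists dL, L, L0, f, psi; split=> //.
apply/seteqP; split=> // x _ D [KD fD].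
apply: (gen D (Kc _ _ _ KD) fD); case: lo Kd {gen} => Kd //= _ u v uv.
  exact: Kd KD _ _ uv.
exact: Kd KD _ _ uv.
Qed.

End Lift.

Theorem theorem4 (P : partialLattice) (d : Order.disp_t) (S : bLatticeType d)
    (phi : conc P -> S) :
  conditionally_co_brouwerian S -> join0_morphism phi ->
  good_lift (@ideal) phi /\ good_lift (@lfilter) phi.
Proof.
move=> hS phiM; split.
- apply: (good_lift_of hS phiM (lo := true)) => dL L D [_ DU Dd].
    split=> // [x y Dx _|x y z _ Dz /andP[_ yz]]; last exact: Dd Dz.
    exact: Dd (leIl x y) Dx.
  by move=> x y; exact: Dd.
- apply: (good_lift_of hS phiM (lo := false)) => dL L D [_ DI Du].
    split=> // [x y Dx _|x y z Dx _ /andP[xy _]]; last exact: Du Dx.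
    exact: Du (leUl x y) Dx.
  by move=> x y; exact: Du.
Qed.
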